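(* Let $(\mathcal{A},\phi)$ be a $W^*$-probability space with a non-degenerated normal state $\phi$, fix $n\in\mathbb{N}$, and let $(x_i)_{i=1,\dots,n}$ be a sequence of selfadjoint random variables in $\mathcal{A}$ such that $\mathcal{A}$ is the WOT closure of the unital algebra generated by $(x_i)_{i=1,\dots,n}$. Then the joint distribution of $(x_i)_{i=1,\dots,n}$ is invariant under the algebraic coaction $\mathcal{L}'_n$ of $\mathcal{B}_s(n)$ if and only if $x_1=x_2=\cdots=x_n$.
   Context: A $W^*$-probability space $(\mathcal{A},\phi)$ is a von Neumann algebra with a normal state; $\phi$ is non-degenerated if $x=0$ whenever $x\in\mathcal{A}$ and $\phi(axb)=0$ for all $a,b\in\mathcal{A}$. WOT is the weak operator topology. $\mu_{x_1,\dots,x_n}:\mathbb{C}\langle X_1,\dots,X_n\rangle\to\mathbb{C}$ is the joint distribution: the linear functional with $\mu(X_{i_1}\cdots X_{i_k})=\phi(x_{i_1}\cdots x_{i_k})$ and $\mu(1)=1$. $B_s(n)$ is the universal unital $C^*$-algebra generated by orthogonal projections $u_{i,j}$ ($i,j=1,\dots,n$) and an orthogonal projection $\mathbf{P}$ such that $u_{i,k}u_{i,l}=0=u_{k,i}u_{l,i}$ whenever $k\ne l$, and $\mathbf{P}=\sum_{k=1}^n u_{k,i}\mathbf{P}$ for all $1\le i\le n$. $\mathcal{B}_s(n)=\mathbf{P}B_s(n)\mathbf{P}$, a $C^*$-algebra with unit $\mathbf{P}$. The algebraic coaction of $\mathcal{B}_s(n)$ is the unital algebra homomorphism $\mathcal{L}'_n:\mathbb{C}\langle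 X_1,\dots,X_n\rangle\to\mathbb{C}\langle X_1,\dots,X_n\rangle\otimes\mathcal{B}_s(n)$ with $\mathcal{L}'_n(X_i)=\sum_{k=1}^nX_k\otimes\mathbf{P}u_{k,i}\mathbf{P}$ (and $\mathcal{L}'_n(1)=1\otimes\mathbf{P}$). The joint distribution of $(x_i)_{i=1,\dots,n}$ is invariant under $\mathcal{L}'_n$ if $\mu_{x_1,\dots,x_n}(p)\mathbf{P}=(\mu_{x_1,\dots,x_n}\otimes id_{\mathcal{B}_s(n)})(\mathcal{L}'_n(p))$ for all $p\in\mathbb{C}\langle X_1,\dots,X_n\rangle$. *)

(* Defs.v *)
From HB Require Import structures.
From mathcomp Require Import all_boot all_order all_algebra.
From mathcomp Require Import all_classical all_reals.
From mathcomp Require Import topology normedtype sequences.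
From mathcomp Require Import complex.
From mathcomp Require Import finmap.
(* The notations of [monalg] clash with those of [analysis]. *)
From mathcomp Require Import -(notations) monalg.

Set Implicit Arguments.
Unset Strict Implicit.
Unset Printing Implicit Defensive.

Import Order.TTheory GRing.Theory Num.Theory.
Import numFieldNormedType.Exports.

Local Open Scope classical_set_scope.
Local Open Scope ring_scope.

(* The inner product is linear in its first argument. *)
HB.mixin Record isHilbert (R : realType) H & CompleteNormedModule R[i] H := {
  hdot : H -> H -> R[i];
  hdotP : forall (a : R[i]) (x y z : H),
    hdot (a *: x + y) z = a * hdot x z + hdot y z;
  hdotC : forall x y : H, hdot y x = (hdot x y)^*;
  hdotxx : forall x : H, hdot x x = `|x| ^+ 2
}.

#[short(type="hilbertType")]
HB.structure Definition Hilbert (R : realType) :=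
  {H of CompleteNormedModule R[i] H & isHilbert R H}.

Section Operators.
Context (R : realType) (H : hilbertType R).
Implicit Types (S T : H -> H) (A : set (H -> H)).

Definition bounded_operators : set (H -> H) :=
  [set T | linear T /\ continuous T].

Definition adjoint T S := forall x y : H, hdot (T x) y = hdot x (S y).

Definition selfadjoint T := adjoint T T.

Definition unital_subalgebra A :=
  [/\ A idfun,
      forall (a : R[i]) S T, A S -> A T -> A (a *: S + T) &
      forall S T, A S -> A T -> A (S \o T)].

Definition wot : Type :=
  initial_topology
    ((fun T (p : H * H) => hdot (T p.1) p.2) :
       (H -> H) -> {ptws H * H -> R[i]^o}).
HB.instance Definition _ := Topological.on wot.

(* The WOT is a topology on the bounded operators, whence the intersection. *)
Definition wot_closure A : set (H -> H) :=
  bounded_operators `&` @closure wot A.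

Record von_neumann_algebra A : Prop := {
  vna_bounded : A `<=` bounded_operators;
  vna_unital_subalgebra : unital_subalgebra A;
  vna_adjoint : forall T, A T -> exists2 S, A S & adjoint T S;
  vna_wot_closed : wot_closure A `<=` A
}.

Record l2seq := L2Seq {
  l2val :> nat -> H;
  l2valP : cvgn (series (fun k => `|l2val k| ^+ 2 : R[i]^o))
}.

(* The ultraweak (sigma-weak) topology is given by the functionals
   T |-> \sum_k <T xi_k, eta_k> with xi and eta square-summable. *)
Definition ultraweak : Type :=
  initial_topology
    ((fun T (p : l2seq * l2seq) =>
        limn (series (fun k => hdot (T (p.1 k)) (p.2 k) : R[i]^o))) :
       (H -> H) -> {ptws l2seq * l2seq -> R[i]^o}).
HB.instance Definition _ := Topological.on ultraweak.

(* A state on A; the values of phi outside A are irrelevant. Normality is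
   ultraweak continuity on A. *)
Record normal_state A (phi : (H -> H) -> R[i]) : Prop := {
  state_linear : forall (a : R[i]) S T,
    A S -> A T -> phi (a *: S + T) = a * phi S + phi T;
  state_pos : forall S T, A S -> A T -> adjoint T S -> 0 <= phi (S \o T);
  state_unit : phi idfun = 1;
  state_normal :
    {within (A : set ultraweak), continuous (phi : ultraweak -> R[i]^o)}
}.

Definition nondegenerated A (phi : (H -> H) -> R[i]) :=
  forall T, A T ->
    (forall S S', A S -> A S' -> phi (S \o T \o S') = 0) -> T = 0.

End Operators.

(* Unital, complex, and nonzero since [GRing.Algebra] requires 1 != 0. The
   norm is a field of the mixin because the hierarchy has no structure joining
   noncommutative rings and normed modules. *)
HB.mixin Record isCStar (R : realType) A & GRing.Algebra R[i] A := {
  cnorm : A -> R;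
  star : A -> A;
  cnorm_eq0 : forall x : A, cnorm x = 0 -> x = 0;
  cnormD : forall x y : A, cnorm (x + y) <= cnorm x + cnorm y;
  cnormZ : forall (a : R[i]) (x : A),
    (cnorm (a *: x))%:C%C = `|a| * (cnorm x)%:C%C;
  cnormM : forall x y : A, cnorm (x * y) <= cnorm x * cnorm y;
  cnorm_complete : forall v : nat -> A,
    (forall e, 0 < e ->
       \forall p \near (\oo, \oo), cnorm (v p.1 - v p.2) < e) ->
    exists l, cnorm (v k - l) @[k --> \oo] --> (0 : R);
  starP : forall (a : R[i]) (x y : A),
    star (a *: x + y) = a^* *: star x + star y;
  starM : forall x y : A, star (x * y) = star y * star x;
  starK : involutive star;
  cnorm_star : forall x : A, cnorm (star x * x) = cnorm x ^+ 2
}.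

#[short(type="cstarType")]
HB.structure Definition CStar (R : realType) :=
  {A of GRing.Algebra R[i] A & isCStar R A}.

Definition projection (R : realType) (B : cstarType R) (p : B) :=
  star p = p /\ p * p = p.

Record star_morphism (R : realType) (B D : cstarType R) (f : B -> D) : Prop := {
  star_morphism_linear : linear f;
  star_morphism1 : f 1 = 1;
  star_morphismM : forall x y, f (x * y) = f x * f y;
  star_morphism_star : forall x, f (star x) = star (f x)
}.

Record Bs_relations (R : realType) (B : cstarType R) (n : nat)
    (u : 'I_n -> 'I_n -> B) (P : B) : Prop := {
  Bs_proj : forall i j, projection (u i j);
  Bs_projP : projection P;
  Bs_row : forall i k l, k != l -> u i k * u i l = 0;
  Bs_col : forall i k l, k != l -> u k i * u l i = 0;
  Bs_sum : forall i, P = \sum_k u k i * P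
}.

(* The universal property determines (B, u, P) up to a unique isomorphism; its
   uniqueness clause says that u and P generate B. *)
Definition is_Bs (R : realType) (B : cstarType R) (n : nat)
    (u : 'I_n -> 'I_n -> B) (P : B) : Prop :=
  Bs_relations u P /\
  forall (D : cstarType R) (v : 'I_n -> 'I_n -> D) (Q : D), Bs_relations v Q ->
    exists! f : B -> D,
      [/\ star_morphism f, forall i j, f (u i j) = v i j & f P = Q].

(* K<X_1, ..., X_n>: the monoid algebra over K of the free monoid on 'I_n; the
   coefficients commute with the X_i, but K itself need not be commutative.
   For a complex algebra K it is C<X_1, ..., X_n> \otimes K, the elementary tensor
   X_w \otimes b of a word w and b in K being [monom b w]. *)
Notation ncpoly K n := (malg (fmonom 'I_n) K).

Definition monom (K : nzRingType) n (b : K) (w : fmonom 'I_n) : ncpoly K n :=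
  mkmalgU w b.

Definition ncX (K : nzRingType) n (i : 'I_n) : ncpoly K n :=
  monom 1 (fmu i).

Lemma monomM (K : nzRingType) n (b c : K) (v w : fmonom 'I_n) :
  monom b v * monom c w = monom (b * c) (mul v w).
Proof. by rewrite /monom malgM_def fgmulUU. Qed.

Section JointDistribution.
Context (R : realType) (H : hilbertType R) (phi : (H -> H) -> R[i]).
Context (n : nat) (x : 'I_n -> H -> H).

Definition eval_word (w : fmonom 'I_n) : H -> H :=
  foldr (fun i T => x i \o T) idfun (fmonom_val w).

Definition joint_distribution (p : ncpoly R[i] n) : R[i] :=
  \sum_(w <- msupp p) mcoeff w p * phi (eval_word w).

Lemma joint_distribution_monom c w :
  joint_distribution (monom c w) = c * phi (eval_word w).
Proof.
rewrite /joint_distribution /monom msuppU; case: eqP => [->|_].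
  by rewrite big_nil mul0r.
by rewrite big_seq_fset1 mcoeffUU.
Qed.

End JointDistribution.

Section Coaction.
Context (R : realType) (B : cstarType R) (n : nat).
Context (u : 'I_n -> 'I_n -> B) (P : B).

Definition coaction_gen (i : 'I_n) : ncpoly B n :=
  \sum_k monom (P * u k i * P) (fmu k).

Definition coaction_word (w : fmonom 'I_n) : ncpoly B n :=
  monom P one * \prod_(i <- fmonom_val w) coaction_gen i.

(* L'_n, with C<X> \otimes P B P seen inside C<X> \otimes B. If P is
   idempotent, it is, by the lemmas below, the algebra homomorphism with L'_n(1) = 1 \otimes P and
   L'_n(X_i) = \sum_k X_k \otimes P u_{k,i} P, and its coefficients lie in P B P. *)
Definition coaction (p : ncpoly R[i] n) : ncpoly B n :=
  mmap (fun c : R[i] => monom (c *: 1 : B) one) coaction_word p.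

Definition tensor_id (mu : ncpoly R[i] n -> R[i]) (q : ncpoly B n) : B :=
  \sum_(w <- msupp q) mu (monom 1 w) *: mcoeff w q.

Lemma tensor_id_monom (mu : ncpoly R[i] n -> R[i]) (b : B) w :
  tensor_id mu (monom b w) = mu (monom 1 w) *: b.
Proof.
rewrite /tensor_id /monom msuppU; case: eqP => [->|_].
  by rewrite big_nil scaler0.
by rewrite big_seq_fset1 mcoeffUU.
Qed.

Definition coaction_invariant (mu : ncpoly R[i] n -> R[i]) :=
  forall p : ncpoly R[i] n, mu p *: P = tensor_id mu (coaction p).

End Coaction.

Section CoactionTheory.

Local Lemma corner_prod (A : nzRingType) (I : Type) (e : A) (g : I -> A) (s : seq I) :
  e * e = e -> (forall i, g i * e = g i) ->
  (e * \prod_(i <- s) g i) * e = e * \prod_(i <- s) g i.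
Proof.
move=> ee ge; elim/last_ind: s => [|s i _]; first by rewrite big_nil mulr1.
by rewrite -cats1 big_cat big_seq1 -!mulrA ge.
Qed.

Local Lemma corner_prod_cat (A : nzRingType) (I : Type) (e : A) (g : I -> A) (s t : seq I) :
  e * e = e -> (forall i, g i * e = g i) ->
  e * \prod_(i <- s ++ t) g i =
  (e * \prod_(i <- s) g i) * (e * \prod_(i <- t) g i).
Proof. by move=> ee ge; rewrite mulrA corner_prod// -mulrA big_cat. Qed.

Local Lemma mulr_comm_ACA (A : nzRingType) (a x b y : A) :
  b * x = x * b -> (a * b) * (x * y) = (a * x) * (b * y).
Proof. by move=> bx; rewrite !mulrA -(mulrA a) bx mulrA. Qed.

Context (R : realType) (B : cstarType R) (n : nat).
Context (u : 'I_n -> 'I_n -> B) (P : B).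

Local Notation L := (coaction u P).
Let cst_ncpoly : R[i] -> ncpoly B n := fun c => monom (c *: 1 : B) one.

Local Lemma cst_is_additive : additive cst_ncpoly.
Proof. by move=> a b; rewrite /cst_ncpoly /monom scalerBl monalgUB. Qed.
HB.instance Definition _ := GRing.isAdditive.Build _ _ cst_ncpoly cst_is_additive.

Lemma coaction_monom (c : R[i]) w :
  L (monom c w) = monom (c *: 1 : B) one * coaction_word u P w.
Proof. exact: (mmapU (f := cst_ncpoly)). Qed.

Lemma coactionD p q : L (p + q) = L p + L q.
Proof. exact: (raddfD (mmap cst_ncpoly (coaction_word u P))). Qed.

Local Lemma coaction_sum (I : Type) r (F : I -> ncpoly R[i] n) :
  L (\sum_(i <- r) F i) = \sum_(i <- r) L (F i).
Proof. exact: (raddf_sum (mmap cst_ncpoly (coaction_word u P))). Qed.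

Local Lemma cstC c (q : ncpoly B n) : cst_ncpoly c * q = q * cst_ncpoly c.
Proof.
rewrite (monalgE q) mulr_sumr mulr_suml; apply: eq_bigr => w _.
by rewrite !monomM mul1m mulm1 -scalerAl -scalerAr mul1r mulr1.
Qed.

Local Lemma cstM c d : cst_ncpoly (c * d) = cst_ncpoly c * cst_ncpoly d.
Proof. by rewrite monomM mul1m -scalerAl mul1r scalerA. Qed.

Context (PP : P * P = P).
Let P1 : ncpoly B n := monom P one.

Local Lemma mulPgen i : P1 * coaction_gen u P i = coaction_gen u P i.
Proof.
rewrite mulr_sumr; apply: eq_bigr => k _.
by rewrite monomM mul1m !mulrA PP.
Qed.

Local Lemma mulgenP i : coaction_gen u P i * P1 = coaction_gen u P i.
Proof.
rewrite mulr_suml; apply: eq_bigr => k _.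
by rewrite monomM mulm1 -!mulrA PP.
Qed.

Local Lemma mulPP : P1 * P1 = P1. Proof. by rewrite monomM mul1m PP. Qed.

Local Lemma mulwordP w : coaction_word u P w * P1 = coaction_word u P w.
Proof.
have H := @corner_prod _ _ P1 (coaction_gen u P) (fmonom_val w) mulPP mulgenP.
exact: H.
Qed.

Local Lemma coaction_wordM v w :
  coaction_word u P (mul v w) = coaction_word u P v * coaction_word u P w.
Proof.
have H := @corner_prod_cat _ _ P1 (coaction_gen u P) (fmonom_val v)
  (fmonom_val w) mulPP mulgenP.
by rewrite {1}/coaction_word -/P1 (fmM v w); exact: H.
Qed.

Local Lemma coaction_monomM c d v w :
  L (monom c v * monom d w) = L (monom c v) * L (monom d w).
Proof.
rewrite monomM [LHS]coaction_monom coaction_wordM.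
rewrite -[monom _ one]/(cst_ncpoly (c * d)) cstM.
have -> : L (monom c v) = cst_ncpoly c * coaction_word u P v.
  exact: coaction_monom.
have -> : L (monom d w) = cst_ncpoly d * coaction_word u P w.
  exact: coaction_monom.
exact: (mulr_comm_ACA _ _ (cstC d (coaction_word u P v))).
Qed.

Lemma coactionM p q : L (p * q) = L p * L q.
Proof.
have E r : L r = \sum_(w <- msupp r) L (monom (mcoeff w r) w).
  by rewrite {1}(monalgE r) coaction_sum.
rewrite (E p) (E q) mulr_suml {1}(monalgE p) mulr_suml coaction_sum.
apply: eq_bigr => v _; rewrite mulr_sumr {1}(monalgE q) mulr_sumr coaction_sum.
by apply: eq_bigr => w _; exact: coaction_monomM.
Qed.

Lemma coaction1 : L (monom 1 one) = monom P one.
Proof.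
have -> : L (monom 1 one) = cst_ncpoly 1 * coaction_word u P one.
  exact: coaction_monom.
have -> : cst_ncpoly 1 = 1 by rewrite /cst_ncpoly scale1r.
by rewrite mul1r /coaction_word fm1 big_nil mulr1.
Qed.

Lemma coactionX i : L (ncX _ i) = \sum_k monom (P * u k i * P) (fmu k).
Proof.
have -> : L (ncX _ i) = cst_ncpoly 1 * coaction_word u P (fmu i).
  exact: coaction_monom.
have -> : cst_ncpoly 1 = 1 by rewrite /cst_ncpoly scale1r.
by rewrite mul1r /coaction_word fmU big_seq1; exact: mulPgen.
Qed.

Lemma coactionZ c p : L (c *: p) = (c *: 1 : B) *: L p.
Proof.
have -> : (c *: 1 : B) *: L p = cst_ncpoly c * L p by rewrite -mul_malgC.
have -> : c *: p = monom c one * p by rewrite -mul_malgC.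
rewrite (monalgE p) mulr_sumr !coaction_sum mulr_sumr.
apply: eq_bigr => w _; rewrite monomM mul1m; move: (mcoeff w p) => d.
transitivity (cst_ncpoly (c * d) * coaction_word u P w).
  exact: coaction_monom.
by rewrite cstM -mulrA; congr (_ * _); rewrite -coaction_monom.
Qed.

Local Lemma mcoeff_P1 q w : mcoeff w (P1 * q * P1) = P * mcoeff w q * P.
Proof.
rewrite [q in LHS]monalgE mulr_sumr mulr_suml [in RHS](monalgE q) !raddf_sum /=.
rewrite mulr_sumr mulr_suml; apply: eq_bigr => v _.
rewrite !monomM mul1m mulm1 /monom !mcoeffU.
by rewrite mulrnAr mulrnAl.
Qed.

Lemma coaction_corner p w :
  mcoeff w (L p) = P * mcoeff w (L p) * P.
Proof.
rewrite -mcoeff_P1; congr mcoeff.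
have PL : P1 * L p = L p.
  have := coactionM (monom 1 one) p.
  by rewrite coaction1 => <-; congr coaction; exact: mul1r.
have LP : L p * P1 = L p.
  have := coactionM p (monom 1 one).
  by rewrite coaction1 => <-; congr coaction; exact: mulr1.
by rewrite PL LP.
Qed.

End CoactionTheory.

(* Main.v *)
(* If all x_i equal x, the column relation P = \sum_k u_{k,i} P makes the
   coaction fix every moment.

   Conversely, sending u_{k,l} to the diagonal 2x2 matrix with entries
   [k = l] and [k = (i j)(l)], and P to the projection onto the vector (1, 1),
   represents B_s(n) on C^2, with the same image of P u_{k,i} P and P u_{k,j} P
   for every k. Hence invariance forces phi(a x_i b) = phi(a x_j b) for all words
   a and b in the x_k, and by linearity for all a and b in the algebra A0 that
   they generate. To reach a and b in its WOT closure A one needs A0 to be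
   ultraweakly dense in A, since a normal state is only ultraweakly continuous;
   this is the bicommutant argument, applied to the closure of an orbit A0 v in
   the Hilbert space l2(H). Nondegeneracy then gives x_i = x_j. *)
Require Import Defs.
From HB Require Import structures.
From mathcomp Require Import all_boot all_order all_algebra.
From mathcomp Require Import all_classical all_reals.
From mathcomp Require Import topology normedtype sequences.
From mathcomp Require Import complex finmap perm.
From mathcomp Require Import -(notations) monalg.
From mathcomp Require Import ring lra.

Set Implicit Arguments.
Unset Strict Implicit.
Unset Printing Implicit Defensive.

Import Order.TTheory GRing.Theory Num.Theory.
Import numFieldNormedType.Exports.

Local Open Scope classical_set_scope.
Local Open Scope ring_scope.

(** * Projections for a real inner product *)

(** Square-summable sequences form a set in [nat -> H], not a type with its own structure, so the
    projection theorem is proved for a form [d] on a set [L] of vectors. The form is the real part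
    of an inner product: its sums and infima then live in [R]. The bicommutant argument loses
    nothing by this, since it tests vectors through [rdot] and uses of the projection that it is
    symmetric, commutes with the operators of the algebra and fixes the closed orbit; its matrix
    entries have adjoint entries, which carries the commutation to the WOT closure.

    The representation on C^2 works because compression by a rank-one projection averages a diagonal
    matrix, so exchanging the two diagonal entries is invisible after compression. As the image of P
    is nonzero, the scalars in front of it can be compared.

    An ultraweak neighbourhood involves several sequences, an orbit only one; interleaving merges
    them. The factors a and b leave A0 one after the other, so that each limit is taken with the
    other factor fixed. *)

Section RealProjection.
Context (R : realType) (V : lmodType R[i]) (L : set V) (d : V -> V -> R).
Local Notation rs a := (a%:C%C : R[i]).
Hypothesis L0 : L 0.
Hypothesis LP : forall (a : R) v w, L v -> L w -> L (rs a *: v + w).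
Hypothesis dP : forall (a : R) u v w, L u -> L v -> L w ->
  d (rs a *: u + v) w = a * d u w + d v w.
Hypothesis dC : forall v w, d v w = d w v.
Hypothesis d_ge0 : forall v, L v -> 0 <= d v v.
Hypothesis d_eq0 : forall v, L v -> d v v = 0 -> v = 0.
Hypothesis d_complete : forall v : nat -> V, (forall k, L (v k)) ->
  (forall e, 0 < e -> exists N, forall k l, (N <= k)%N -> (N <= l)%N ->
     d (v k - v l) (v k - v l) < e) ->
  exists2 w, L w & forall e, 0 < e -> exists N, forall k, (N <= k)%N ->
     d (w - v k) (w - v k) < e.

(** The minimum over t is at t = b / c. For c = 0 the expression is affine in t, and unless b = 0
    the t chosen below gives it the value -1. *)
Lemma real_discriminant (a b c : R) :
  (forall t : R, 0 <= a - 2 * t * b + t ^+ 2 * c) -> 0 <= c -> b ^+ 2 <= a * c.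
Proof.
move=> h; rewrite le_eqVlt => /predU1P[c0|c0].
  move: h; rewrite -{}c0 => h.
  rewrite mulr0; have [->|b0] := eqVneq b 0; first by rewrite expr0n.
  have := h (b^-1 * (a + 1) / 2); rewrite mulr0 addr0.
  have -> : a - 2 * (b^-1 * (a + 1) / 2) * b = - 1 by field.
  by rewrite ler0N1.
have := h (b / c).
have -> : a - 2 * (b / c) * b + (b / c) ^+ 2 * c = (a * c - b ^+ 2) / c.
  by field; rewrite gt_eqF.
by rewrite pmulr_lge0 ?invr_gt0// subr_ge0.
Qed.

Let LZ a v : L v -> L (rs a *: v).
Proof. by move=> Lv; have := LP a Lv L0; rewrite addr0. Qed.
Let LD v w : L v -> L w -> L (v + w).
Proof. by move=> Lv Lw; have := LP 1 Lv Lw; rewrite scale1r. Qed.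
Let LN v : L v -> L (- v).
Proof. by move=> /(@LZ (-1)); rewrite rmorphN rmorph1 scaleN1r. Qed.
Let LB v w : L v -> L w -> L (v - w).
Proof. by move=> Lv Lw; apply: LD => //; exact: LN. Qed.
Let dDl u v w : L u -> L v -> L w -> d (u + v) w = d u w + d v w.
Proof. by move=> Lu Lv Lw; have := dP 1 Lu Lv Lw; rewrite scale1r mul1r. Qed.
Let d0l w : L w -> d 0 w = 0.
Proof. by move=> Lw; have := dP 1 L0 L0 Lw; rewrite scaler0 addr0 mul1r; lra. Qed.
Let dZl a u w : L u -> L w -> d (rs a *: u) w = a * d u w.
Proof. by move=> Lu Lw; have := dP a Lu L0 Lw; rewrite !addr0 d0l// addr0. Qed.
Let dNl u w : L u -> L w -> d (- u) w = - d u w.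
Proof.
by move=> Lu Lw; have := dZl (-1) Lu Lw; rewrite rmorphN rmorph1 scaleN1r mulN1r.
Qed.
Let dBl u v w : L u -> L v -> L w -> d (u - v) w = d u w - d v w.
Proof. by move=> Lu Lv Lw; rewrite dDl ?dNl//; exact: LN. Qed.
Let dZr a u w : L u -> L w -> d u (rs a *: w) = a * d u w.
Proof. by move=> *; rewrite dC dZl// dC. Qed.
Let dBr u v w : L u -> L v -> L w -> d w (u - v) = d w u - d w v.
Proof. by move=> *; rewrite dC dBl// !(dC w). Qed.
Let dDr u v w : L u -> L v -> L w -> d w (u + v) = d w u + d w v.
Proof. by move=> *; rewrite dC dDl// !(dC w). Qed.

Lemma form_cauchy_schwarz u v : L u -> L v -> d u v ^+ 2 <= d u u * d v v.
Proof.
move=> Lu Lv; apply: real_discriminant; last exact: d_ge0.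
move=> t; have Ltv := LZ t Lv; have := d_ge0 (LB Lu Ltv).
rewrite !dBl ?dBr ?dZl ?dZr ?(dC v u)//; last exact: LB.
by move/le_trans; apply; rewrite le_eqVlt; apply/orP; left; apply/eqP; ring.
Qed.

Context (M : set V).
Hypothesis ML : M `<=` L.
Hypothesis M0 : M 0.
Hypothesis MP : forall (a : R) v w, M v -> M w -> M (rs a *: v + w).

(** The norm closure of [M] in [L], with squared distances so that no square root enters. *)
Definition form_closure : set V :=
  [set v | L v /\ forall e, 0 < e -> exists2 m, M m & d (v - m) (v - m) < e].

Definition is_projection v p :=
  form_closure p /\ forall m, form_closure m -> d (v - p) m = 0.

Lemma sub_form_closure : M `<=` form_closure.
Proof.
move=> m Mm; split; first exact: ML.
by move=> e e0; exists m => //; rewrite subrr d0l.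
Qed.

(** Subtracting an m of [M] from w leaves d v w unchanged, and Cauchy-Schwarz then makes it small.
    The + 1 in the tolerance guards against d v v = 0. *)
Lemma orthogonal_form_closure v : L v -> (forall m, M m -> d v m = 0) ->
  forall m, form_closure m -> d v m = 0.
Proof.
move=> Lv vM w [Lw cw]; apply/eqP; rewrite -sqrf_eq0 eq_le sqr_ge0 andbT.
apply/ler_addgt0Pr => e e0; rewrite add0r.
have e'0 : 0 < e / (d v v + 1).
  by apply: divr_gt0 => //; have := d_ge0 Lv; lra.
have [m Mm wm] := cw _ e'0.
have Lm := ML Mm; have -> : d v w = d v (w - m) by rewrite dBr// (vM m)// subr0.
apply: le_trans (form_cauchy_schwarz Lv (LB Lw Lm)) _.
have v0 := d_ge0 Lv; have v1 : 0 < d v v + 1 by lra.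
move: wm; rewrite ltr_pdivlMr// => wm.
have := d_ge0 (LB Lw Lm); nra.
Qed.

Lemma projection_unique v p p' : L v ->
  is_projection v p -> is_projection v p' -> p = p'.
Proof.
move=> Lv [[Lp cp] op] [[Lp' cp'] op']; apply/eqP; rewrite -subr_eq0; apply/eqP.
apply: d_eq0; first exact: LB.
have h : d (p - p') p = 0 /\ d (p - p') p' = 0.
  have := op _ (conj Lp cp); have := op' _ (conj Lp cp).
  have := op _ (conj Lp' cp'); have := op' _ (conj Lp' cp').
  rewrite !dBl//; lra.
by rewrite dBr ?h.1 ?h.2 ?subrr//; exact: LB.
Qed.

(** A sequence in [M] minimising the distance to v is Cauchy, and its limit is the projection. *)
Lemma projection_exists v : L v -> exists p, is_projection v p.
Proof.
move=> Lv; pose q w := d w w.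
pose E : set R := [set q (v - m) | m in M].
have E0 : has_inf E.
  split; first by exists (q (v - 0)), 0.
  by exists 0 => _ [m Mm <-]; apply/d_ge0/LB => //; exact: ML.
have q_ge m : M m -> inf E <= q (v - m).
  by move=> Mm; apply: ge_inf; [exact: E0.2|exists m].
have /choice[m /all_and2[Mm qm]] k : exists m, M m /\ q (v - m) < inf E + k.+1%:R^-1.
  have /(inf_adherent (eps := k.+1%:R^-1)) : has_inf E by [].
  have k0 : (0 : R) < k.+1%:R^-1 by rewrite invr_gt0 ltr0n.
  by move=> /(_ k0)[_ [w Mw <-] h]; exists w.
have Lm k : L (m k) by exact/ML.
have qD a b : L a -> L b -> q (a + b) = q a + 2 * d a b + q b.
  move=> La Lb; rewrite /q dDl ?dDr//; last exact: LD.
  by rewrite (dC b a); ring.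
have qB a b : L a -> L b -> q (a - b) = q a - 2 * d a b + q b.
  move=> La Lb; rewrite /q dBl ?dBr//; last exact: LB.
  by rewrite (dC b a); ring.
have qZ t a : L a -> q (rs t *: a) = t ^+ 2 * q a.
  by move=> La; rewrite /q dZl ?dZr//; [ring|exact: LZ].
(* Parallelogram law: the midpoint of m k and m l is in [M], hence at squared distance at least
   [inf E] from v. *)
have cauchy k l : q (m k - m l) <= 2 * (k.+1%:R^-1 + l.+1%:R^-1).
  have Mh : M (rs 2^-1 *: (m k + m l)).
    have := MP 2^-1 (MP 1 (Mm k) (Mm l)) M0.
    by rewrite scale1r addr0.
  have := q_ge _ Mh; have := qm k; have := qm l.
  set vk := v - m k; set vl := v - m l.
  have Lk : L vk by exact: LB.
  have Ll : L vl by exact: LB.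
  have -> : m k - m l = vl - vk by rewrite /vl /vk opprB [RHS]addrC addrA subrK.
  have -> : v - rs 2^-1 *: (m k + m l) = rs 2^-1 *: (vk + vl).
    have {1}<- : rs 2^-1 *: (v + v) = v.
      rewrite fmorphV rmorph_nat -mulr2n -(scaler_nat 2 v) scalerA.
      by rewrite mulVf ?scale1r// pnatr_eq0.
    by rewrite -scalerBr opprD addrACA.
  rewrite qZ; last exact: LD.
  rewrite qD// qB// (dC vl) expr2.
  move: (k.+1%:R^-1) (l.+1%:R^-1) (q vk) (q vl) (d vk vl) (inf E) => x y a b c f.
  by lra.
have inv_small (e : R) : 0 < e -> exists N, forall k, (N <= k)%N -> k.+1%:R^-1 < e.
  move=> e0; have e'0 : 0 < e^-1 by rewrite invr_gt0.
  exists (Num.truncn e^-1).+1 => k Nk; rewrite invf_plt ?posrE//.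
  apply: lt_le_trans (truncnS_gt _) _.
  by rewrite ler_nat; exact: leq_trans Nk _.
have [p Lp mp] : exists2 w, L w & forall e, 0 < e -> exists N, forall k, (N <= k)%N ->
     d (w - m k) (w - m k) < e.
  apply: d_complete => // e e0; have [|N hN] := inv_small (e / 4); first lra.
  exists N => k l Nk Nl; apply: le_lt_trans (cauchy k l) _.
  have := hN _ Nk; have := hN _ Nl.
  by move: (k.+1%:R^-1) (l.+1%:R^-1) => x y; lra.
exists p; split.
  split=> // e e0; have [N hN] := mp _ e0.
  by exists (m N) => //; exact: hN.
have Lvp : L (v - p) by exact: LB.
apply: orthogonal_form_closure => // w Mw; have Lw := ML Mw.
have qw0 : 0 <= q w by exact: d_ge0.
(* Moving m k along w stays in [M], so it lowers the squared distance to v by at most 1 / (k + 1).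
   This almost orthogonality passes to the limit p. *)
have Dk k : d (v - m k) w ^+ 2 <= k.+1%:R^-1 * q w.
  apply: real_discriminant => // t.
  have Mt : M (rs t *: w + m k) by exact: MP.
  have Lvk : L (v - m k) by exact: LB.
  have := q_ge _ Mt; have := qm k.
  have -> : v - (rs t *: w + m k) = (v - m k) - rs t *: w.
    by rewrite opprD addrA addrAC.
  rewrite (qB (v - m k) (rs t *: w))//; last exact: LZ.
  by rewrite qZ// dZr//; move: (k.+1%:R^-1) => x; lra.
apply/eqP; rewrite -sqrf_eq0 eq_le sqr_ge0 andbT.
apply/ler_addgt0Pr => e e0; rewrite add0r.
(* The factor 4 comes from (a - b)^2 <= 2 (a^2 + b^2), where each square has to be at most e / 4. *)
have e'0 : 0 < e / (4 * (q w + 1)) by apply: divr_gt0 => //; lra.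
have [N1 h1] := inv_small _ e'0; have [N2 h2] := mp _ e'0.
pose k := maxn N1 N2.
have Lpk : L (p - m k) by exact: LB.
have Lvk : L (v - m k) by exact: LB.
have -> : d (v - p) w = d (v - m k) w - d (p - m k) w.
  by rewrite -dBl//; congr (d _ w); rewrite opprB addrA subrK.
have := Dk k; have := form_cauchy_schwarz Lpk Lw.
have := h1 k (leq_maxl _ _); have := h2 k (leq_maxr _ _).
rewrite !ltr_pdivlMr; [|lra|lra].
rewrite -/(q w); have : 0 <= d (p - m k) (p - m k) by exact: d_ge0.
have : 0 <= k.+1%:R^-1 :> R by rewrite invr_ge0 ler0n.
move: (d (v - m k) w) (d (p - m k) w) (k.+1%:R^-1) (d (p - m k) _) => a b c f.
move=> c0 f0 fe ce bf ac.
have : (a - b) ^+ 2 <= 2 * (a ^+ 2 + b ^+ 2).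
  rewrite -subr_ge0.
  have -> : 2 * (a ^+ 2 + b ^+ 2) - (a - b) ^+ 2 = (a + b) ^+ 2 by ring.
  exact: sqr_ge0.
have : (c + f) * (4 * (q w + 1)) < 2 * e by rewrite mulrDl; lra.
have : 0 <= c + f by lra.
nra.
Qed.

Lemma projection_in v : form_closure v -> is_projection v v.
Proof. by move=> cv; split => // m [Lm _]; rewrite subrr d0l. Qed.

(** Both sides equal d p q. *)
Lemma projection_sym v w p q : L v -> L w ->
  is_projection v p -> is_projection w q -> d p w = d v q.
Proof.
move=> Lv Lw [cp op] [cq oq].
have := op _ cq; have := oq _ cp; case: cp cq => Lp _ [Lq _].
by rewrite !dBl// (dC q) (dC w); lra.
Qed.

End RealProjection.

(** * Square-summable sequences in a Hilbert space *)

Section RealDot.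
Context (R : realType) (H : hilbertType R).
Implicit Types (x y z : H) (a : R).
Local Notation rs a := (a%:C%C : R[i]).

(* Working with the real part lets the sums in [l2] below converge in [R],
   which is known to be complete, instead of [R[i]]. *)
Definition rdot x y : R := complex.Re (hdot x y).
Definition sqn x : R := rdot x x.

Lemma rdotP a x y z : rdot (rs a *: x + y) z = a * rdot x z + rdot y z.
Proof.
rewrite /rdot hdotP; case: (hdot x z) (hdot y z) => [p q] [p' q'] /=.
by rewrite mul0r subr0.
Qed.

Lemma rdotC x y : rdot x y = rdot y x.
Proof. by rewrite /rdot hdotC; case: (hdot y x). Qed.

Lemma sqnE x : rs (sqn x) = `|x| ^+ 2.
Proof.
by rewrite /sqn /rdot -hdotxx RRe_real// hdotxx realX// normr_real.
Qed.

Lemma sqn_ge0 x : 0 <= sqn x.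
Proof. by rewrite -ler0c sqnE exprn_ge0. Qed.

Lemma sqn_eq0 x : sqn x = 0 -> x = 0.
Proof.
by move=> x0; apply/eqP; rewrite -normr_eq0 -sqrf_eq0 -sqnE x0.
Qed.

Lemma sqn_lt x (e : R) : 0 <= e -> (sqn x < e ^+ 2) = (`|x| < rs e).
Proof.
move=> e0; rewrite -ltcR sqnE rmorphXn ltr_pXn2r// ?nnegrE ?ler0c//.
Qed.

Lemma sqnZ (c : R[i]) x : sqn (c *: x) = complex.Re (`|c| ^+ 2) * sqn x.
Proof.
have e : rs (complex.Re (`|c| ^+ 2)) = `|c| ^+ 2.
  by rewrite RRe_real// realX// normr_real.
by apply: (@complexI R); rewrite sqnE normrZ exprMn -sqnE -{1}e -rmorphM.
Qed.

Lemma hdotDl x y z : hdot (x + y) z = hdot x z + hdot y z.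
Proof. by have := hdotP 1 x y z; rewrite scale1r mul1r. Qed.
Lemma hdot0l z : hdot 0 z = 0.
Proof.
have := hdotP 1 (0 : H) 0 z; rewrite scaler0 addr0 mul1r.
by move=> /(canLR (addrK _)); rewrite subrr.
Qed.
Lemma hdotZl (c : R[i]) x z : hdot (c *: x) z = c * hdot x z.
Proof. by have := hdotP c x 0 z; rewrite !addr0 hdot0l addr0. Qed.
Lemma rdotDl x y z : rdot (x + y) z = rdot x z + rdot y z.
Proof. by have := rdotP 1 x y z; rewrite scale1r mul1r. Qed.
Lemma rdot0l z : rdot 0 z = 0.
Proof. by rewrite /rdot hdot0l. Qed.
Lemma rdotZl a x z : rdot (rs a *: x) z = a * rdot x z.
Proof. by have := rdotP a x 0 z; rewrite !addr0 rdot0l addr0. Qed.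
Lemma rdotNl x z : rdot (- x) z = - rdot x z.
Proof. by have := rdotZl (-1) x z; rewrite rmorphN rmorph1 scaleN1r mulN1r. Qed.
Lemma rdotBl x y z : rdot (x - y) z = rdot x z - rdot y z.
Proof. by rewrite rdotDl rdotNl. Qed.
Lemma rdotBr x y z : rdot z (x - y) = rdot z x - rdot z y.
Proof. by rewrite rdotC rdotBl !(rdotC z). Qed.
Lemma rdotDr x y z : rdot z (x + y) = rdot z x + rdot z y.
Proof. by rewrite rdotC rdotDl !(rdotC z). Qed.
Lemma rdotZr a x z : rdot z (rs a *: x) = a * rdot z x.
Proof. by rewrite rdotC rdotZl rdotC. Qed.

Lemma rdot_inj x y : (forall z, rdot x z = rdot y z) -> x = y.
Proof.
move=> h; apply/eqP; rewrite -subr_eq0; apply/eqP/sqn_eq0.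
by rewrite /sqn rdotBl h subrr.
Qed.

(* AM-GM: the weight [t] will later be chosen large. *)
Lemma rdot_le (t : R) x y : 0 < t -> 2 * `|rdot x y| <= t * sqn x + sqn y / t.
Proof.
move=> t0; have h (s : R) : s ^+ 2 = 1 -> 2 * (s * rdot x y) <= t * sqn x + sqn y / t.
  move=> s1; have := sqn_ge0 (rs t *: x - rs s *: y).
  rewrite /sqn rdotBl !rdotBr !rdotZl !rdotZr (rdotC y x) -!/(sqn _) => h.
  rewrite -(ler_pM2l t0) -subr_ge0.
  have -> : t * (t * sqn x + sqn y / t) - t * (2 * (s * rdot x y)) =
      t ^+ 2 * sqn x - 2 * t * s * rdot x y + s ^+ 2 * sqn y.
    by rewrite s1; field; rewrite gt_eqF.
  apply: le_trans h _; rewrite le_eqVlt; apply/orP; left; apply/eqP.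
  by ring.
have [r0|r0] := leP 0 (rdot x y).
  by have := h 1 (expr1n _ _); rewrite mul1r ger0_norm.
have := h (-1); rewrite sqrrN expr1n mulN1r ltr0_norm//; exact.
Qed.

(** The imaginary part of <x, y> is the real part of <-i x, y>, and -i x has the same [sqn] as x; by
    [rdot_le] each part is at most half of the bound. *)
Lemma hdot_le (t : R) x y : 0 < t -> `|hdot x y| <= rs (t * sqn x + sqn y / t).
Proof.
move=> t0; have hRe := rdot_le x y t0.
have hIm := rdot_le ((- 'i%C) *: x) y t0.
have e : rdot ((- 'i%C) *: x) y = complex.Im (hdot x y).
  rewrite /rdot hdotZl; case: (hdot x y) => p q /=.
  by rewrite mulN1r opprK oppr0 mul0r add0r.
rewrite e sqnZ in hIm.
have i1 : complex.Re (`|(- 'i)%C| ^+ 2 : R[i]) = 1.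
  by rewrite sqr_normc /=; simpc; rewrite /= ?oppr0 ?opprK ?mul0r ?mulr1 ?add0r ?subr0.
rewrite i1 mul1r in hIm.
have -> : hdot x y = rs (complex.Re (hdot x y)) + 'i%C * rs (complex.Im (hdot x y)).
  exact: complexE.
apply: le_trans (ler_normD _ _) _.
rewrite normrM.
have -> : `|'i%C| = 1 :> R[i].
  by rewrite normc_def /= expr0n add0r expr1n sqrtr1.
have nr (p : R) : `|rs p| = rs `|p| by rewrite normc_def /= expr0n addr0 sqrtr_sqr.
rewrite mul1r !nr -rmorphD lecR.
by move: hRe; rewrite /rdot; lra.
Qed.

Lemma sqn_le2 x y : sqn (x + y) <= 2 * sqn x + 2 * sqn y.
Proof.
have := rdot_le x y ltr01; rewrite invr1 mulr1 mul1r /sqn rdotDl !rdotDr (rdotC y x).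
by have := ler_norm (rdot x y); lra.
Qed.

Lemma bounded_sqn (T : H -> H) : bounded_operators T ->
  exists2 C : R, 0 <= C & forall x, sqn (T x) <= C * sqn x.
Proof.
move=> [lT cT]; pose T' : {linear H -> H} := HB.pack T (GRing.isLinear.Build _ _ _ _ T lT).
have /linear_boundedP[M [Mr hM]] : bounded_near T' (nbhs 0).
  exact/linear_bounded_continuous.
have {}hM x : `|T x| <= (`|M| + 1) * `|x|.
  apply: hM; apply: le_lt_trans (real_ler_norm Mr) _.
  by rewrite ltrDl.
have [C CM] : exists C : R, rs C = (`|M| + 1) ^+ 2.
  exists (complex.Re ((`|M| + 1) ^+ 2)).
  by rewrite RRe_real// realX// realD.
exists C => [|x]; first by rewrite -ler0c CM exprn_ge0 ?addr_ge0.
rewrite -lecR (rmorphM (real_complex R)) sqnE [X in _ <= X * _]CM [X in _ <= _ * X]sqnE -exprMn.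
by rewrite lerXn2r ?nnegrE// mulr_ge0// addr_ge0.
Qed.

End RealDot.

(** * The space l2(H) with its real inner product *)

Section SquareSummable.
Context (R : realType) (H : hilbertType R).
Implicit Types (v w : nat -> H) (a : R).
Local Notation rs a := (a%:C%C : R[i]).

(** Unlike in [l2seq], the series is real, so bounded partial sums suffice for convergence;
    [l2valP_l2] links the two notions. *)
Definition l2 : set (nat -> H) := [set v | cvgn (series (fun k => sqn (v k)))].
Definition ldot v w : R := limn (series (fun k => rdot (v k) (w k))).
Definition single (i : nat) (h : H) : nat -> H := fun k => if k == i then h else 0.

Lemma l2_sum_le v K : l2 v -> \sum_(0 <= k < K) sqn (v k) <= ldot v v.
Proof.
move=> lv; apply: (@nondecreasing_cvgn_le R (series (fun k => sqn (v k)))) => //.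
by apply: nondecreasing_series => *; exact: sqn_ge0.
Qed.

Lemma l2_bounded v (C : R) : (forall K, \sum_(0 <= k < K) sqn (v k) <= C) -> l2 v.
Proof.
move=> vC; apply: nondecreasing_is_cvgn; last by exists C => _ [K _ <-]; exact: vC.
by apply: nondecreasing_series => *; exact: sqn_ge0.
Qed.

Lemma ldot_le v (C : R) : (forall K, \sum_(0 <= k < K) sqn (v k) <= C) -> ldot v v <= C.
Proof.
move=> vC; apply: (@limr_le _ _ _ _ C (series (fun k => sqn (v k)))).
  exact: (l2_bounded vC).
by apply: nearW => K; exact: vC.
Qed.

Lemma l2P a v w : l2 v -> l2 w -> l2 (rs a *: v + w).
Proof.
move=> lv lw; apply: (@l2_bounded _ (2 * a ^+ 2 * ldot v v + 2 * ldot w w)) => K.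
apply: le_trans (_ : \sum_(0 <= k < K) (2 * a ^+ 2 * sqn (v k) + 2 * sqn (w k)) <= _).
  apply: ler_sum => k _; apply: le_trans (sqn_le2 _ _) _.
  rewrite lerD2r /sqn rdotZl rdotZr.
  by rewrite le_eqVlt; apply/orP; left; apply/eqP; ring.
rewrite big_split/= -!mulr_sumr lerD// ler_wpM2l ?l2_sum_le//.
by rewrite mulr_ge0// sqr_ge0.
Qed.

Lemma l20 : l2 0.
Proof.
apply: (@l2_bounded _ 0) => K; rewrite big1// => k _.
by rewrite /sqn rdot0l.
Qed.

Lemma cvg_ldot v w : l2 v -> l2 w -> cvgn (series (fun k => rdot (v k) (w k))).
Proof.
move=> lv lw; apply: (@normed_cvg R R^o).
apply: (@series_le_cvg _ _ (fun k => sqn (v k) + sqn (w k))) => [k|k|k|].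
- exact: normr_ge0.
- by rewrite addr_ge0// sqn_ge0.
- have := rdot_le (v k) (w k) ltr01; rewrite mul1r divr1 /=.
  by have := normr_ge0 (rdot (v k) (w k)); lra.
- exact: is_cvg_seriesD.
Qed.

Lemma ldotP a v w z : l2 v -> l2 w -> l2 z ->
  ldot (rs a *: v + w) z = a * ldot v z + ldot w z.
Proof.
move=> lv lw lz; rewrite /ldot.
have cv := cvg_ldot lv lz; have cw := cvg_ldot lw lz.
rewrite -[a * _](lim_seriesZ a cv) -(lim_seriesD _ cw); last exact: is_cvg_seriesZ.
congr (limn (series _)); apply/funext => k /=.
exact: rdotP.
Qed.

Lemma ldotC v w : ldot v w = ldot w v.
Proof. by congr (limn (series _)); apply/funext => k; rewrite rdotC. Qed.

Lemma ldot_ge0 v : l2 v -> 0 <= ldot v v.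
Proof. by move=> /(l2_sum_le 0); rewrite big_nil. Qed.

Lemma sqn_le_ldot v k : l2 v -> sqn (v k) <= ldot v v.
Proof.
move=> lv; apply: le_trans (l2_sum_le k.+1 lv).
by rewrite big_nat_recr//= lerDr sumr_ge0// => *; exact: sqn_ge0.
Qed.

Lemma ldot_eq0 v : l2 v -> ldot v v = 0 -> v = 0.
Proof.
move=> lv v0; apply/funext => k; apply: sqn_eq0; apply/eqP.
by rewrite eq_le sqn_ge0 andbT -v0 sqn_le_ldot.
Qed.

Lemma l2_single i h : l2 (single i h).
Proof.
apply: (@l2_bounded _ (sqn h)) => K.
rewrite (eq_bigr (fun k => if k == i then sqn h else 0)).
  by rewrite -big_mkcond big_nat1_eq; case: ifP => // _; exact: sqn_ge0.
by move=> k _; rewrite /single; case: ifP => // _; rewrite /sqn rdot0l.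
Qed.

Lemma ldot_single v i h : ldot v (single i h) = rdot (v i) h.
Proof.
apply: cvg_lim => //; apply: cvg_near_cst; exists i.+1 => // K /= iK.
rewrite /series/= (eq_bigr (fun k => if k == i then rdot (v i) h else 0)).
  by rewrite -big_mkcond big_nat1_eq iK.
by move=> k _; rewrite /single; case: eqP => [->//|_]; rewrite rdotC rdot0l.
Qed.

Lemma l2_bounded_operator (T : H -> H) v : bounded_operators T -> l2 v -> l2 (T \o v).
Proof.
move=> /bounded_sqn[C C0 TC] lv; apply: (@l2_bounded _ (C * ldot v v)) => K.
apply: le_trans (_ : \sum_(0 <= k < K) (C * sqn (v k)) <= _).
  by apply: ler_sum => k _; exact: TC.
by rewrite -mulr_sumr ler_wpM2l// l2_sum_le.
Qed.

(** Radii of balls in [H] are elements of [R[i]]; the positive ones are real, which turns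
    completeness of [H] into a statement about [sqn]. *)
Lemma hilbert_cauchy (h : nat -> H) :
  (forall e : R, 0 < e -> exists N, forall k l, (N <= k)%N -> (N <= l)%N ->
     sqn (h k - h l) < e) ->
  exists x, forall e : R, 0 < e -> exists N, forall k, (N <= k)%N -> sqn (x - h k) < e.
Proof.
move=> ch; have posE (e : R[i]) : 0 < e -> exists2 r : R, 0 < r & e = rs r.
  move=> e0; exists (complex.Re e); last by rewrite RRe_real// gtr0_real.
  by rewrite -ltcR RRe_real// gtr0_real.
have : cvg (h @ \oo).
  apply/cauchy_cvgP/cauchyP => _ /posE[r r0 ->].
  have [|N hN] := ch (r ^+ 2); first by rewrite exprn_gt0.
  exists (h N); exists N => // k /= Nk.
  by rewrite -ball_normE /= -sqn_lt ?ltW//; exact: hN.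
case/cvg_ex => x /cvgrPdist_lt hx; exists x => e e0.
have [|N _ hN] := hx (rs (Num.sqrt e)); first by rewrite ltcR sqrtr_gt0.
exists N => k /hN; rewrite -sqn_lt ?sqrtr_ge0// sqr_sqrtr//.
exact: ltW.
Qed.

(** The limit is taken in each component; convergence in norm follows from bounds on finite partial
    sums. *)
Lemma l2_complete (v : nat -> nat -> H) : (forall k, l2 (v k)) ->
  (forall e : R, 0 < e -> exists N, forall k l, (N <= k)%N -> (N <= l)%N ->
     ldot (v k - v l) (v k - v l) < e) ->
  exists2 w, l2 w & forall e : R, 0 < e -> exists N, forall k, (N <= k)%N ->
     ldot (w - v k) (w - v k) < e.
Proof.
move=> lv cv.
have lB f g : l2 f -> l2 g -> l2 (f - g).
  by move=> lf lg; have := @l2P (-1) _ _ lg lf; rewrite rmorphN rmorph1 scaleN1r addrC.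
have /choice[w wP] i : exists x, forall e : R, 0 < e -> exists N, forall k, (N <= k)%N ->
    sqn (x - v k i) < e.
  apply: hilbert_cauchy => e /cv[N hN]; exists N => k l Nk Nl.
  exact: le_lt_trans (sqn_le_ldot i (lB _ _ (lv k) (lv l))) (hN _ _ Nk Nl).
have wS K : forall e : R, 0 < e -> exists N, forall k, (N <= k)%N ->
    \sum_(0 <= i < K) sqn (w i - v k i) < e.
  elim: K => [|K IH] e e0; first by exists 0 => k _; rewrite big_nil.
  have e20 : 0 < e / 2 by rewrite divr_gt0.
  have [N1 h1] := IH _ e20; have [N2 h2] := wP K _ e20.
  exists (maxn N1 N2) => k; rewrite geq_max => /andP[/h1 ? /h2 ?].
  by rewrite big_nat_recr//= [e]splitr ltrD.
(* N is independent of K: only the intermediate term [v l], close to w on the first K components,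
   depends on K. *)
have near_w (e : R) : 0 < e -> exists N, forall k, (N <= k)%N ->
    forall K, \sum_(0 <= i < K) sqn ((w - v k) i) <= e.
  move=> e0; have e40 : 0 < e / 4 by rewrite divr_gt0.
  have [N hN] := cv _ e40; exists N => k Nk K.
  have [N' hN'] := wS K _ e40; pose l := maxn N N'.
  have := hN l k (leq_maxl _ _) Nk; have := hN' l (leq_maxr _ _).
  have := l2_sum_le K (lB _ _ (lv l) (lv k)).
  have : \sum_(0 <= i < K) sqn ((w - v k) i) <=
    2 * \sum_(0 <= i < K) sqn (w i - v l i) + 2 * \sum_(0 <= i < K) sqn ((v l - v k) i).
    rewrite !mulr_sumr -big_split/=; apply: ler_sum => i _.
    by apply: le_trans (sqn_le2 _ _); rewrite addrA subrK.
  by lra.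
exists w.
  have [N /(_ _ (leqnn N))/l2_bounded lwv] := near_w _ ltr01.
  by have := @l2P 1 _ _ lwv (lv N); rewrite scale1r subrK.
move=> e e0; have [|N hN] := near_w (e / 2); first by rewrite divr_gt0.
exists N => k /hN/ldot_le /le_lt_trans; apply.
by rewrite ltr_pdivrMr// mulr_natr mulr2n ltrDl.
Qed.

End SquareSummable.

(** * Ultraweak density *)

Section UltraweakDensity.
Context (R : realType) (H : hilbertType R).
Implicit Types (S T Q : H -> H).
Local Notation rs a := (a%:C%C : R[i]).

Lemma linear_subr T : linear T -> forall x y, T (x - y) = T x - T y.
Proof. by move=> Tl x y; rewrite addrC -scaleN1r Tl scaleN1r addrC. Qed.

Lemma wot_eval_continuous (p : H * H) :
  continuous ((fun T => hdot (T p.1) p.2) : wot H -> R[i]^o).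
Proof.
pose F := (fun T (p : H * H) => hdot (T p.1) p.2) : (H -> H) -> {ptws H * H -> R[i]^o}.
move=> T; apply: (@continuous_comp (wot H) _ _ F (proj p)).
  exact: initial_continuous.
exact: proj_continuous.
Qed.

(** A WOT neighbourhood controls finitely many coefficients at once; the commutation argument
    compares two. *)
Lemma wot_closure_approx (A : set (H -> H)) T (h g h' g' : H) (e : R) :
  closure (A : set (wot H)) T -> 0 < e ->
  exists2 S, A S & `|rdot (T h) g - rdot (S h) g| < e /\
                   `|rdot (T h') g' - rdot (S h') g'| < e.
Proof.
move=> clT e0; have hE (p : H * H) : nbhs (T : wot H)
    [set S : wot H | `|hdot (T p.1) p.2 - hdot (S p.1) p.2| < rs e].
  have /cvgrPdist_lt := @wot_eval_continuous p T; apply.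
  by rewrite ltcR.
have [S [AS [/= S1 S2]]] := clT _ (filterI (hE (h, g)) (hE (h', g'))).
have hRe (z z' : R[i]) : `|z - z'| < rs e -> `|complex.Re z - complex.Re z'| < e.
  move=> zz; rewrite -ltcR; apply: le_lt_trans zz.
  by apply: le_trans (normc_ge_Re _); case: z => ? ?; case: z' => ? ? /=.
by exists S => //; split; exact: hRe.
Qed.

(** The adjoint [Q'] turns both sides, tested against g, into coefficients of T, namely <T (Q h), g>
    and <T h, Q' g>. These are WOT-continuous in T and agree on A. *)
Lemma wot_closure_commute (A : set (H -> H)) Q Q' T :
  (forall h g, rdot (Q h) g = rdot h (Q' g)) ->
  (forall S, A S -> forall h, S (Q h) = Q (S h)) ->
  closure (A : set (wot H)) T -> forall h, T (Q h) = Q (T h).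
Proof.
move=> QQ' QA clT h; apply: rdot_inj => g; rewrite QQ'.
apply/eqP; rewrite -subr_eq0 -normr_le0; apply/ler_addgt0Pr => e e0; rewrite add0r.
have [|S AS [h1 h2]] := wot_closure_approx (Q h) g h (Q' g) clT (e := e / 2).
  by rewrite divr_gt0.
have e1 : rdot (S (Q h)) g = rdot (S h) (Q' g) by rewrite QA// QQ'.
rewrite e1 in h1; apply: ltW.
rewrite -(subrKA (rdot (S h) (Q' g))) [e]splitr.
apply: le_lt_trans (ler_normD _ _) _; rewrite ltrD// distrC//.
Qed.

(* The bicommutant argument: the components of the orthogonal projection of
   l2(H) onto the closure of the orbit [A v] commute with [A], hence with
   its WOT closure. *)
Lemma wot_closure_l2_approx (A : set (H -> H)) T T' v (e : R) :
  unital_subalgebra A -> A `<=` @bounded_operators R H ->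
  (forall S, A S -> exists2 S', A S' & adjoint S S') ->
  wot_closure A T -> wot_closure A T' -> adjoint T T' ->
  l2 v -> 0 < e ->
  exists2 S, A S & l2 ((T - S) \o v) /\ ldot ((T - S) \o v) ((T - S) \o v) < e.
Proof.
move=> [A1 AP AM] Ab Aadj [Tb clT] [T'b clT'] TT' lv e0.
pose M : set (nat -> H) := [set S \o v | S in A].
have radj S S' : adjoint S S' -> forall x y, rdot (S x) y = rdot x (S' y).
  by move=> SS' x y; rewrite /rdot SS'.
have ladj S S' : adjoint S S' -> forall x y, ldot (S \o x) y = ldot x (S' \o y).
  move=> SS' x y; congr (limn (series _)); apply/funext => k.
  exact: radj.
have A0 S : A S -> A 0.
  move=> AS; have := AP (-1) S S AS AS.
  by rewrite scaleN1r addNr.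
have ML : M `<=` @l2 R H.
  by move=> _ [S /Ab Sb <-]; exact: l2_bounded_operator.
have M0 : M 0 by exists 0; [exact: A0 A1|].
have MP (a : R) f g : M f -> M g -> M (rs a *: f + g).
  by move=> [S AS <-] [S' AS' <-]; exists (rs a *: S + S') => //; exact: AP.
pose d := @ldot R H; pose L := @l2 R H.
have dL0 : L 0 := @l20 R H.
have dLP : forall (a : R) f g, L f -> L g -> L (rs a *: f + g) by move=> *; exact: l2P.
have dP : forall (a : R) f g z, L f -> L g -> L z ->
  d (rs a *: f + g) z = a * d f z + d g z by move=> *; exact: ldotP.
have dC : forall f g, d f g = d g f := @ldotC R H.
have d_ge0 : forall f, L f -> 0 <= d f f := @ldot_ge0 R H.
have d_eq0 : forall f, L f -> d f f = 0 -> f = 0 := @ldot_eq0 R H.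
have d_complete := @l2_complete R H.
pose isP := is_projection L d M.
have Pex f : L f -> exists p, isP f p.
  exact: projection_exists.
(* Choice needs a value at every f; outside [L] it is the default 0. *)
have /choice[P PP] f : exists p, L f -> isP f p.
  by have [/Pex[p]|nf] := pselect (L f); [exists p|exists 0].
have Puniq f p : L f -> isP f p -> P f = p.
  by move=> Lf; apply: (projection_unique dL0 dLP dP dC d_eq0 Lf); exact: PP.
have Psym f g : L f -> L g -> d (P f) g = d f (P g).
  by move=> Lf Lg; apply: (projection_sym dL0 dLP dP dC Lf Lg); exact: PP.
have LPf f : L f -> L (P f) by move=> /PP[[]].
have Sinv S f : A S -> form_closure L d M f -> form_closure L d M (S \o f).
  move=> AS [Lf cf]; have Sb := Ab _ AS; split; first exact: l2_bounded_operator.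
  move=> r r0; have [C C0 SC] := bounded_sqn Sb.
  have C1 : 0 < C + 1 by lra.
  have [_ [S' AS' <-] hm] := cf (r / (C + 1)) (divr_gt0 r0 C1).
  exists (S \o (S' \o v)); first by exists (S \o S') => //; exact: AM.
  have Lfm : L (f - (S' \o v)).
    have := dLP (-1) _ _ (ML _ (ex_intro2 _ _ _ AS' erefl)) Lf.
    by rewrite rmorphN rmorph1 scaleN1r addrC.
  apply: le_lt_trans (_ : C * d (f - (S' \o v)) (f - (S' \o v)) < _).
    apply: ldot_le => K; apply: le_trans (_ : \sum_(0 <= k < K)
        (C * sqn ((f - (S' \o v)) k)) <= _).
      apply: ler_sum => k _; apply: le_trans (SC _); rewrite /=.
      have -> : S (f k - S' (v k)) = S (f k) - S (S' (v k)).
        exact: linear_subr Sb.1 _ _.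
      exact: lexx.
    by rewrite -mulr_sumr ler_wpM2l// l2_sum_le.
  move: hm; rewrite ltr_pdivlMr// => hm.
  have := d_ge0 _ Lfm; nra.
(* As [A] is stable under adjoints, the orthogonal of [M] is invariant too. *)
have SP S f : A S -> L f -> P (S \o f) = S \o P f.
  move=> AS Lf; have Sb := Ab _ AS; have [cP oP] := PP _ Lf.
  have [S' AS' SS'] := Aadj _ AS.
  apply: Puniq; first exact: l2_bounded_operator.
  split; first exact: Sinv.
  move=> m cm; have -> : (S \o f) - (S \o P f) = S \o (f - P f).
    by apply/funext => k; exact/esym/(linear_subr Sb.1).
  rewrite /d (ladj _ _ SS'); apply: oP; exact: Sinv.
(* The matrix entries of the projection on l2(H); as it is symmetric, the (j, i) entry is adjoint to
   the (i, j) entry. *)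
pose Q i j h := P (single j h) i.
have QQ i j h g : rdot (Q i j h) g = rdot h (Q j i g).
  rewrite /Q -ldot_single -/d Psym; try exact: l2_single.
  by rewrite dC /d ldot_single rdotC.
have S_single S j h : linear S -> S \o single j h = single j (S h).
  move=> Sl; apply/funext => k; rewrite /single/=; case: ifP => // _.
  by have := linear_subr Sl 0 0; rewrite !subrr.
have QS S i j h : A S -> S (Q i j h) = Q i j (S h).
  move=> AS; rewrite /Q -S_single; last exact: (Ab _ AS).1.
  by rewrite SP//; exact: l2_single.
have T'P i h : T' \o P (single i h) = P (single i (T' h)).
  apply/funext => k.
  by apply: (wot_closure_commute (QQ k i) _ clT') => S AS g; exact: QS.
have lTv : L (T \o v) by exact: l2_bounded_operator.
have Pv : P v = v.
  apply: Puniq => //; apply: (projection_in dL0 dP); apply: (sub_form_closure dL0 dP ML).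
  by exists idfun.
(* Each component is tested against a sequence with one nonzero term. There [T'] passes through P by
   [T'P], so no infinite matrix product appears. *)
have PTv : P (T \o v) = T \o v.
  apply/funext => i; apply: rdot_inj => g.
  rewrite -ldot_single -/d Psym//; last exact: l2_single.
  rewrite /d (ladj _ _ TT') T'P -/d -Psym//; last exact: l2_single.
  by rewrite Pv /d ldot_single /= (radj _ _ TT').
have [[_ cT] _] := PP _ lTv; rewrite PTv in cT.
have [_ [S AS <-] hS] := cT _ e0; exists S => //; split=> //.
have := dLP (-1) _ _ (ML _ (ex_intro2 _ _ _ AS erefl)) lTv.
by rewrite rmorphN rmorph1 scaleN1r addrC.
Qed.

(** A bound on the square sum along the merged sequence bounds it along both; this gives a filter
    base in [normal_state_dense]. *)
Definition interleave (v w : nat -> H) : nat -> H :=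
  fun k => if odd k then w k./2 else v k./2.

Lemma interleave_sum (f : H -> R) v w K :
  \sum_(0 <= k < K) f (interleave v w k) =
  \sum_(0 <= k < uphalf K) f (v k) + \sum_(0 <= k < K./2) f (w k).
Proof.
elim: K => [|K IH]; first by rewrite !big_nil addr0.
rewrite big_nat_recr//= IH /interleave uphalf_half.
case: (odd K); rewrite ?add1n ?add0n.
  by rewrite [X in _ = _ + X]big_nat_recr//= addrA.
by rewrite [X in _ = X + _]big_nat_recr//= addrAC.
Qed.

Lemma l2_interleave v w : l2 v -> l2 w -> l2 (interleave v w).
Proof.
move=> lv lw; apply: (@l2_bounded _ _ _ (ldot v v + ldot w w)) => K.
by rewrite interleave_sum lerD// l2_sum_le.
Qed.

(** Beyond some N the complex partial sums are within 1 of their limit l, and the partial sums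
    increase, so Re l + 1 bounds them all. *)
Lemma l2valP_l2 (v : l2seq H) : l2 (l2val v).
Proof.
have /cvg_ex[l /cvgrPdist_lt /(_ 1 ltr01)[N _ hN]] := @l2valP _ _ v.
apply: (@l2_bounded _ _ _ (complex.Re l + 1)) => K.
apply: (@le_trans _ _ (\sum_(0 <= k < maxn N K) sqn (v k))).
  apply: nondecreasing_series (leq_maxr _ _) => *; exact: sqn_ge0.
have := hN _ (leq_maxl N K).
rewrite /series /= -(eq_bigr _ (fun k _ => sqnE (v k))) -rmorph_sum /= distrC => h.
have := le_lt_trans (normc_ge_Re _) h; case: (l) => p q /=.
rewrite ltcR => {}h; have := le_lt_trans (ler_norm _) h.
lra.
Qed.

End UltraweakDensity.

(** * Passing from a generating algebra to its closure under a normal state *)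

Section NormalState.
Context (R : realType) (H : hilbertType R).
Implicit Types (S T Q L : H -> H).
Local Notation rs a := (a%:C%C : R[i]).

(* [limn] of a divergent sequence is the junk value [0], so no convergence is
   needed here. *)
Lemma limn_norm_le (s : nat -> R[i]^o) (e : R) :
  (forall K, `|s K| <= rs e) -> `|limn s : R[i]| <= rs e.
Proof.
move=> se; have [cs|/dvgP->] := pselect (cvgn s); last first.
  by apply: le_trans (se 0); rewrite normr0.
apply/ler_addgt0Pr => r r0; have /cvgrPdist_lt/(_ r r0)[K _ hK] := cs.
have := hK K (leqnn K) => /ltW h.
by rewrite -[X in `|X|](subrK (s K)) (le_trans (ler_normD _ _))// addrC lerD.
Qed.

Definition ultraweak_pairing T (p : l2seq H * l2seq H) : R[i]^o :=
  limn (series (fun k => hdot (T (p.1 k)) (p.2 k) : R[i]^o)).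

(** The topology is initial for a map into a product, so convergence is tested on one coordinate at
    a time. *)
Lemma ultraweak_cvg (F : set_system (H -> H)) T : Filter F ->
  (forall p (e : R), 0 < e ->
    F [set S | `|ultraweak_pairing T p - ultraweak_pairing S p| < rs e]) ->
  F --> (T : ultraweak H).
Proof.
move=> FF h U [_ [[B Bo <-] BT] BU].
suff : (ultraweak_pairing : (H -> H) -> {ptws l2seq H * l2seq H -> R[i]^o}) @ F -->
    (ultraweak_pairing T : {ptws l2seq H * l2seq H -> R[i]^o}).
  move=> /(_ B) hB; apply: filterS BU _; apply: hB.
  exact: open_nbhs_nbhs.
apply/cvg_sup => p V [_ [[C Co <-] CT] CV].
apply: (filterS CV).
have /(_ _ (open_nbhs_nbhs (conj Co CT))) : 
    (ultraweak_pairing ^~ p) @ F --> ultraweak_pairing T p.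
  apply/cvgrPdist_lt => e e0.
  have := h p (complex.Re e); rewrite RRe_real ?gtr0_real// => hh.
  by apply: hh; rewrite -ltcR RRe_real// gtr0_real.
by [].
Qed.

(** As S in [A0] approaches T along sequences, L (T - S) Q tends ultraweakly to 0, while its value
    under [phi] stays equal to phi (L T Q). *)
Lemma normal_state_dense (A A0 : set (H -> H)) (phi : (H -> H) -> R[i]) L Q T :
  von_neumann_algebra A -> normal_state A phi ->
  unital_subalgebra A0 -> A0 `<=` A ->
  (forall S, A0 S -> exists2 S', A0 S' & adjoint S S') ->
  A = wot_closure A0 -> A L -> A Q ->
  (forall S, A0 S -> phi (L \o S \o Q) = 0) -> A T -> phi (L \o T \o Q) = 0.
Proof.
move=> vA nphi uA0 A0A adjA0 AE AL AQ phi0 AT.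
have Ab := vna_bounded vA; have [A1 AP AM] := vna_unital_subalgebra vA.
have [T' AT' TT'] := vna_adjoint vA AT.
have Lb := Ab _ AL; have Qb := Ab _ AQ.
have AB S S' : A S -> A S' -> A (S - S').
  by move=> AS AS'; have := AP (-1) _ _ AS' AS; rewrite scaleN1r addrC.
have approx v (e : R) : l2 v -> 0 < e -> exists2 S, A0 S &
    l2 ((T - S) \o v) /\ ldot ((T - S) \o v) ((T - S) \o v) < e.
  move=> lv e0; apply: (wot_closure_l2_approx uA0 _ adjA0 _ _ TT' lv e0).
  - by move=> S /A0A /Ab.
  - by rewrite -AE.
  - by rewrite -AE.
(* An index consists of a sequence along which S approximates T and a tolerance. *)
pose G (i : (nat -> H) * R) := [set L \o (T - S) \o Q | S in
  [set S | A0 S /\ l2 ((T - S) \o i.1) /\ ldot ((T - S) \o i.1) ((T - S) \o i.1) < i.2]].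
pose I : set ((nat -> H) * R) := [set i | l2 i.1 /\ 0 < i.2].
pose F := filter_from I G.
have FF : Filter F.
  apply: filter_from_filter; first by exists (0, 1); split; [exact: l20|].
  move=> [v e] [w r] [/= lv e0] [/= lw r0].
  exists (interleave v w, Num.min e r).
    by split; [exact: l2_interleave|rewrite /= lt_min e0].
  move=> _ [S [AS [lS hS]] <-]; rewrite /= lt_min in hS.
  have part f : l2 f -> (forall K, exists K', 
      \sum_(0 <= k < K) sqn ((T - S) (f k)) <=
      \sum_(0 <= k < K') sqn ((T - S) (interleave v w k))) ->
      l2 ((T - S) \o f) /\ ldot ((T - S) \o f) ((T - S) \o f) <=
        ldot ((T - S) \o interleave v w) ((T - S) \o interleave v w).
    move=> lf hf; have hb K : \sum_(0 <= k < K) sqn (((T - S) \o f) k) <=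
        ldot ((T - S) \o interleave v w) ((T - S) \o interleave v w).
      by have [K' hK] := hf K; apply: le_trans hK (l2_sum_le K' lS).
    by split; [exact: l2_bounded hb|exact: ldot_le].
  have [e1 e2] := andP hS.
  split; exists S => //; split => //=.
    have [|l1 h1] := part v lv; last by split => //; exact: le_lt_trans e1.
    move=> K; exists K.*2; rewrite (interleave_sum (fun x => sqn ((T - S) x))) doubleK.
    by rewrite uphalf_double lerDl sumr_ge0// => *; exact: sqn_ge0.
  have [|l1 h1] := part w lw; last by split => //; exact: le_lt_trans e2.
  move=> K; exists K.*2; rewrite (interleave_sum (fun x => sqn ((T - S) x))) doubleK.
  by rewrite uphalf_double lerDr sumr_ge0// => *; exact: sqn_ge0.
have F0 : F --> (0 : ultraweak H).
  apply: ultraweak_cvg => -[xi eta] e e0.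
  have -> : ultraweak_pairing 0 (xi, eta) = 0.
    apply: cvg_lim => //; apply: cvg_near_cst; apply: nearW => K.
    by rewrite /series/= big1// => k _; rewrite hdot0l.
  have lxi := @l2valP_l2 R H xi; have leta := @l2valP_l2 R H eta.
  have [C C0 LC] := bounded_sqn Lb.
  have n0 : 0 <= ldot eta eta := ldot_ge0 leta.
  (* This weight in [hdot_le] makes the share of [eta] at most e / 4. The tolerance below does the
     same for [xi]; the total e / 2 leaves room for the strict inequality after the limit. *)
  have [t t0 tE] : exists2 t, 0 < t & t = 4 * (ldot eta eta + 1) / e.
    by exists (4 * (ldot eta eta + 1) / e) => //; rewrite divr_gt0//; lra.
  (* [Q] is absorbed into the sequence and [L] into its bound [C]. *)
  exists (Q \o xi, e / (4 * t * (C + 1))).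
    split; first exact: l2_bounded_operator.
    by rewrite /= divr_gt0// mulr_gt0 ?mulr_gt0//; lra.
  move=> _ [S [AS [lS hS]] <-] /=; rewrite sub0r normrN.
  apply: le_lt_trans (_ : rs (e / 2) < _); last by rewrite ltcR; lra.
  apply: limn_norm_le => K; apply: le_trans (ler_norm_sum _ _ _) _.
  apply: le_trans (_ : \sum_(0 <= k < K)
    rs (t * C * sqn ((T - S) (Q (xi k))) + sqn (eta k) / t) <= _).
    apply: ler_sum => k _; apply: le_trans (hdot_le _ _ t0) _.
    rewrite lecR lerD2r -mulrA ler_wpM2l//; first exact: ltW.
    exact: LC.
  rewrite -rmorph_sum lecR big_split/= -mulr_sumr -mulr_suml.
  have h1 := l2_sum_le K lS; have h2 := l2_sum_le K leta.
  have h3 : (\sum_(0 <= k < K) sqn (eta k)) / t <= e / 4.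
    rewrite ler_pdivrMr// tE.
    have -> : e / 4 * (4 * (ldot eta eta + 1) / e) = ldot eta eta + 1.
      by field; rewrite gt_eqF.
    by lra.
  have h4 : t * C * \sum_(0 <= k < K) sqn ((T - S) (Q (xi k))) <= e / 4.
    move: hS; rewrite /= ltr_pdivlMr ?mulr_gt0//; last by lra.
    have := @ldot_ge0 _ _ _ lS.
    move: (ldot _ _) h1 => N h1 N0 hN.
    have tC : 0 <= t * C by rewrite mulr_ge0// ltW.
    apply: le_trans (ler_wpM2l tC h1) _.
    have tN : 0 <= t * N by rewrite mulr_ge0// ltW.
    have -> : t * C * N = C * (t * N) by ring.
    have : N * (4 * t * (C + 1)) = 4 * (C * (t * N)) + 4 * (t * N) by ring.
    lra.
  by lra.
apply/eqP; rewrite -normr_le0; apply/ler_addgt0Pr => r r0; rewrite add0r.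
have Azero : A 0 by have := AB _ _ A1 A1; rewrite subrr.
have phiB S S' : A S -> A S' -> phi (S - S') = phi S - phi S'.
  move=> AS AS'; have := state_linear nphi (-1) AS' AS.
  by rewrite scaleN1r mulN1r [X in phi X]addrC [RHS]addrC.
have phiz : phi 0 = 0 by have := phiB _ _ A1 A1; rewrite !subrr.
have := @state_normal _ _ _ _ nphi (0 : H -> H).
move=> /cvgrPdist_lt/(_ r r0) near0.
have {near0} : within (A : set (ultraweak H)) (nbhs (0 : ultraweak H))
    [set S | `|phi 0 - phi S| < r].
  by rewrite (nbhs_subspace_in (Azero : (A : set (ultraweak H)) 0)); exact: near0.
rewrite phiz.
move=> /F0[[v e] [lv e0] hG].
have [S AS hS] := approx v e lv e0.
have := hG (L \o (T - S) \o Q) (ex_intro2 _ _ S (conj AS hS) erefl).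
have AS' := A0A _ AS.
move=> /(_ (AM _ _ (AM _ _ AL (AB _ _ AT AS')) AQ)) /=.
rewrite sub0r normrN.
have -> : L \o (T - S) \o Q = (L \o T \o Q) - (L \o S \o Q).
  by apply/funext => h /=; exact: (linear_subr Lb.1).
rewrite (phiB _ _ (AM _ _ (AM _ _ AL AT) AQ) (AM _ _ (AM _ _ AL AS') AQ)).
by rewrite (phi0 S)// subr0; exact: ltW.
Qed.

End NormalState.

(** * Complex matrices as a C*-algebra *)

Section MatrixCStar.
Context (R : realType) (n : nat).
Local Notation rs a := (a%:C%C : R[i]).
Local Notation C := R[i].
Implicit Types (x y : 'cV[C]_n.+1) (a b : 'M[C]_n.+1).

(** The modulus takes values in [R[i]], whereas [cnorm] must be real. *)
Definition cabs (z : C) : R := complex.Re `|z|.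

Lemma cabsE z : rs (cabs z) = `|z|.
Proof. by rewrite RRe_real// normr_real. Qed.

Lemma cabs_ge0 z : 0 <= cabs z.
Proof. by rewrite -ler0c cabsE. Qed.

Lemma cabsM z z' : cabs (z * z') = cabs z * cabs z'.
Proof. by apply: (@complexI R); rewrite cabsE normrM -!cabsE -rmorphM. Qed.

Lemma cabs_eq0 z : cabs z = 0 -> z = 0.
Proof. by move=> z0; apply/eqP; rewrite -normr_eq0 -cabsE z0. Qed.

Lemma cabs_sqr z : cabs z ^+ 2 = complex.Re (z * z^*).
Proof. by apply: (@complexI R); rewrite rmorphXn/= cabsE -normCK RRe_real// realX// normr_real. Qed.

Lemma cabs_Re z : `|complex.Re z| <= cabs z.
Proof. by rewrite -lecR cabsE; exact: normc_ge_Re. Qed.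

Lemma cabs_Im z : `|complex.Im z| <= cabs z.
Proof.
have := cabs_Re (z * 'i%C); rewrite cabsM ReiNIm normrN.
suff -> : cabs 'i%C = 1 by rewrite mulr1.
by apply: (@complexI R); rewrite cabsE normc_def/= expr0n add0r expr1n sqrtr1.
Qed.

Lemma cabs_le z : cabs z <= `|complex.Re z| + `|complex.Im z|.
Proof.
rewrite -lecR cabsE {1}(complexE z) rmorphD; apply: le_trans (ler_normD _ _) _.
have nr (p : R) : `|rs p| = rs `|p| by rewrite normc_def /= expr0n addr0 sqrtr_sqr.
rewrite normrM !nr lerD2l.
suff -> : `|'i%C| = 1 :> C by rewrite mul1r.
by rewrite normc_def/= expr0n add0r expr1n sqrtr1.
Qed.

(** The real part gives the same norm as the Hermitian product and is a form to which
    [form_cauchy_schwarz] applies. *)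
Definition cvdot x y : R := complex.Re (\sum_i x i 0 * (y i 0)^*).

Definition cvnorm x : R := Num.sqrt (cvdot x x).

Lemma cvdotP (t : R) x y z : cvdot (rs t *: x + y) z = t * cvdot x z + cvdot y z.
Proof.
rewrite /cvdot; under eq_bigr => i _ do rewrite !mxE mulrDl -mulrA.
rewrite big_split/= -mulr_sumr.
by case: (\sum_i _) (\sum_i _) => [p q] [p' q']/=; rewrite mul0r subr0.
Qed.

Lemma cvdotC x y : cvdot x y = cvdot y x.
Proof.
rewrite /cvdot; have -> : \sum_i y i 0 * (x i 0)^* = (\sum_i x i 0 * (y i 0)^*)^*.
  by rewrite rmorph_sum; apply: eq_bigr => i _; rewrite rmorphM/= conjCK mulrC.
by case: (\sum_i _).
Qed.

Lemma cvdotE x : cvdot x x = \sum_i cabs (x i 0) ^+ 2.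
Proof.
rewrite /cvdot; elim/big_rec2: _ => // i r z _ <-; rewrite cabs_sqr.
by case: (_ * _) z => [p q] [p' q'].
Qed.

Lemma cvdot_ge0 x : 0 <= cvdot x x.
Proof. by rewrite cvdotE sumr_ge0// => i _; exact: sqr_ge0. Qed.

Lemma cvdot_cauchy_schwarz x y : cvdot x y ^+ 2 <= cvdot x x * cvdot y y.
Proof.
have h := @form_cauchy_schwarz R 'cV[C]_n.+1 setT cvdot I.
by apply: h => // *; [exact: cvdotP|exact: cvdotC|exact: cvdot_ge0].
Qed.

Lemma cvnorm_ge0 x : 0 <= cvnorm x. Proof. exact: sqrtr_ge0. Qed.

Lemma cvnorm_sqr x : cvnorm x ^+ 2 = cvdot x x.
Proof. by rewrite sqr_sqrtr// cvdot_ge0. Qed.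

Lemma cvdot_le x y : cvdot x y <= cvnorm x * cvnorm y.
Proof.
apply: le_trans (ler_norm _) _.
rewrite -(@ler_pXn2r _ 2)// ?nnegrE ?mulr_ge0 ?cvnorm_ge0//.
by rewrite real_normK ?num_real// exprMn !cvnorm_sqr cvdot_cauchy_schwarz.
Qed.

Lemma cvnormD x y : cvnorm (x + y) <= cvnorm x + cvnorm y.
Proof.
rewrite -(@ler_pXn2r _ 2)// ?nnegrE ?addr_ge0 ?cvnorm_ge0//.
rewrite sqrrD !cvnorm_sqr.
have := cvdotP 1 x y (x + y); rewrite rmorph1 scale1r mul1r => ->.
rewrite !(cvdotC _ (x + y)).
have := cvdotP 1 x y x; have := cvdotP 1 x y y; rewrite rmorph1 !scale1r !mul1r => -> ->.
by rewrite (cvdotC y x); have := cvdot_le x y; lra.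
Qed.

Lemma cabs_le_cvnorm x i : cabs (x i 0) <= cvnorm x.
Proof.
rewrite -(@ler_pXn2r _ 2)// ?nnegrE ?cabs_ge0 ?cvnorm_ge0//.
rewrite cvnorm_sqr cvdotE (bigD1 i)//= lerDl sumr_ge0// => j _; exact: sqr_ge0.
Qed.

Lemma cvnorm_eq0 x : cvnorm x = 0 -> x = 0.
Proof.
move=> x0; apply/matrixP => i j; rewrite mxE ord1; apply: cabs_eq0.
by apply/eqP; rewrite eq_le cabs_ge0 andbT -x0 cabs_le_cvnorm.
Qed.

Lemma cvnormZ z x : cvnorm (z *: x) = cabs z * cvnorm x.
Proof.
apply/eqP; rewrite -(@eqrXn2 _ 2)// ?mulr_ge0 ?cabs_ge0 ?cvnorm_ge0//.
rewrite exprMn !cvnorm_sqr !cvdotE mulr_sumr; apply/eqP/eq_bigr => i _.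
by rewrite mxE cabsM exprMn.
Qed.

Lemma cvnorm0 : cvnorm 0 = 0.
Proof. by rewrite -(scale0r (0 : 'cV_n.+1)) cvnormZ /cabs normr0 mul0r. Qed.

Lemma cvnorm_sum (I : Type) (r : seq I) (F : I -> 'cV[C]_n.+1) :
  cvnorm (\sum_(i <- r) F i) <= \sum_(i <- r) cvnorm (F i).
Proof.
elim/big_ind2: _ => [|x s y t xs yt|//]; first by rewrite cvnorm0.
by apply: le_trans (cvnormD _ _) _; rewrite lerD.
Qed.

Lemma cvnorm_delta i : cvnorm (delta_mx i 0) = 1.
Proof.
apply/eqP; rewrite -(@eqrXn2 _ 2)// ?cvnorm_ge0// cvnorm_sqr cvdotE (bigD1 i)//=.
rewrite !mxE !eqxx big1 => [|j ji]; last first.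
  by rewrite !mxE (negbTE ji) /cabs normr0 expr0n.
by rewrite /cabs normr1 addr0 expr1n.
Qed.

Lemma cvnorm_le x : cvnorm x <= \sum_i cabs (x i 0).
Proof.
have {1}-> : x = \sum_i x i 0 *: delta_mx i 0.
  rewrite {1}(matrix_sum_delta x); apply: eq_bigr => i _.
  by rewrite big_ord1.
apply: le_trans (cvnorm_sum _ _) _; apply: ler_sum => i _.
by rewrite cvnormZ cvnorm_delta mulr1.
Qed.

Definition mxop_bounds a : set R :=
  [set c | 0 <= c /\ forall x, cvnorm (a *m x) <= c * cvnorm x].

Definition mxop_norm a : R := inf (mxop_bounds a).

(** This crude bound makes the set of bounds nonempty, and later derives norm convergence from
    convergence of the entries. *)
Lemma mxop_bounds_sum a : mxop_bounds a (\sum_i \sum_j cabs (a i j)).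
Proof.
have s0 : 0 <= \sum_i \sum_j cabs (a i j).
  by apply: sumr_ge0 => i _; apply: sumr_ge0 => j _; exact: cabs_ge0.
split=> // x; apply: le_trans (cvnorm_le _) _.
rewrite mulr_suml; apply: ler_sum => i _; rewrite mxE mulr_suml.
apply: le_trans (_ : \sum_j cabs (a i j * x j 0) <= _).
  rewrite -lecR cabsE (rmorph_sum (real_complex R)).
  apply: le_trans (ler_norm_sum _ _ _) _.
  by apply: ler_sum => j _; rewrite -cabsE.
by apply: ler_sum => j _; rewrite cabsM ler_wpM2l ?cabs_ge0 ?cabs_le_cvnorm.
Qed.

Lemma mxop_bounds_inf a : has_inf (mxop_bounds a).
Proof.
split; first by exists (\sum_i \sum_j cabs (a i j)); exact: mxop_bounds_sum.
by exists 0 => c [].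
Qed.

Lemma mxop_norm_le a c : 0 <= c -> (forall x, cvnorm (a *m x) <= c * cvnorm x) ->
  mxop_norm a <= c.
Proof. by move=> c0 ac; apply: ge_inf; [exact: (mxop_bounds_inf a).2|]. Qed.

Lemma mxop_norm_ge0 a : 0 <= mxop_norm a.
Proof. by apply: lb_le_inf => [|c []//]; exact: (mxop_bounds_inf a).1. Qed.

Lemma cvnorm_mulmx a x : cvnorm (a *m x) <= mxop_norm a * cvnorm x.
Proof.
have := cvnorm_ge0 x; rewrite le_eqVlt => /predU1P[/esym x0|x0].
  by rewrite (cvnorm_eq0 x0) mulmx0 !cvnorm0 mulr0.
rewrite -ler_pdivrMr//; apply: lb_le_inf; first exact: (mxop_bounds_inf a).1.
by move=> c [_ ac]; rewrite ler_pdivrMr.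
Qed.

Lemma mxop_norm_sum a : mxop_norm a <= \sum_i \sum_j cabs (a i j).
Proof. by have [] := mxop_bounds_sum a; exact: mxop_norm_le. Qed.

Lemma cabs_le_mxop_norm a i j : cabs (a i j) <= mxop_norm a.
Proof.
have := cvnorm_mulmx a (delta_mx j 0); rewrite -colE.
rewrite cvnorm_delta mulr1; apply: le_trans.
by have := cabs_le_cvnorm (col j a) i; rewrite mxE.
Qed.

Lemma mxop_norm_eq0 a : mxop_norm a = 0 -> a = 0.
Proof.
move=> a0; apply/matrixP => i j; rewrite mxE; apply: cabs_eq0.
by apply/eqP; rewrite eq_le cabs_ge0 andbT -a0 cabs_le_mxop_norm.
Qed.

Lemma mxop_normD a b : mxop_norm (a + b) <= mxop_norm a + mxop_norm b.
Proof.
apply: mxop_norm_le => [|x]; first by rewrite addr_ge0// mxop_norm_ge0.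
rewrite mulmxDl mulrDl; apply: le_trans (cvnormD _ _) _.
by rewrite lerD// cvnorm_mulmx.
Qed.

Lemma mxop_normM a b : mxop_norm (a * b) <= mxop_norm a * mxop_norm b.
Proof.
apply: mxop_norm_le => [|x]; first by rewrite mulr_ge0// mxop_norm_ge0.
rewrite -mulmxA -mulrA; apply: le_trans (cvnorm_mulmx _ _) _.
by rewrite ler_wpM2l ?mxop_norm_ge0// cvnorm_mulmx.
Qed.

Lemma mxop_normZ z a : rs (mxop_norm (z *: a)) = `|z| * rs (mxop_norm a).
Proof.
rewrite -cabsE -rmorphM; congr (rs _).
have le w b : mxop_norm (w *: b) <= cabs w * mxop_norm b.
  apply: mxop_norm_le => [|x]; first by rewrite mulr_ge0 ?cabs_ge0 ?mxop_norm_ge0.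
  by rewrite -scalemxAl cvnormZ -mulrA ler_wpM2l ?cabs_ge0 ?cvnorm_mulmx.
apply/eqP; rewrite eq_le le/=.
have [->|z0] := eqVneq z 0; first by rewrite /cabs normr0 mul0r mxop_norm_ge0.
have := le z^-1 (z *: a); rewrite scalerA mulVf// scale1r.
have zz : cabs z * cabs z^-1 = 1.
  by rewrite -cabsM divff// /cabs normr1.
by move=> /(ler_wpM2l (cabs_ge0 z)); rewrite mulrA zz mul1r.
Qed.

Definition mxstar a : 'M[C]_n.+1 := (map_mx Num.conj a)^T.

Lemma mxstarP (z : C) a b : mxstar (z *: a + b) = z^* *: mxstar a + mxstar b.
Proof. by apply/matrixP => i j; rewrite !mxE rmorphD rmorphM. Qed.

Lemma mxstarM a b : mxstar (a * b) = mxstar b * mxstar a.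
Proof. by rewrite /mxstar -[a * b]/(a *m b) map_mxM trmx_mul. Qed.

Lemma mxstarK : involutive mxstar.
Proof. by move=> a; apply/matrixP => i j; rewrite !mxE conjCK. Qed.

Lemma cvdot_mxstar a x y : cvdot (a *m x) y = cvdot x (mxstar a *m y).
Proof.
rewrite /cvdot; congr complex.Re.
under eq_bigr => i _ do rewrite mxE mulr_suml.
rewrite exchange_big; apply: eq_bigr => j _ /=.
rewrite mxE rmorph_sum mulr_sumr; apply: eq_bigr => i _.
by rewrite !mxE rmorphM/= conjCK; ring.
Qed.

(** Cauchy-Schwarz on |b x|^2 = <x, [mxstar b] b x> bounds the square of the norm of b by the norm
    of [mxstar b] b. Submultiplicativity then bounds the norm of b by that of [mxstar b]; as
    [mxstar] is an involution, the two are equal. *)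
Lemma mxop_norm_star a : mxop_norm (mxstar a * a) = mxop_norm a ^+ 2.
Proof.
have le b : mxop_norm b ^+ 2 <= mxop_norm (mxstar b * b).
  rewrite -[leRHS]sqr_sqrtr ?mxop_norm_ge0// ler_pXn2r ?nnegrE ?mxop_norm_ge0 ?sqrtr_ge0//.
  apply: mxop_norm_le => [|x]; first exact: sqrtr_ge0.
  rewrite -(@ler_pXn2r _ 2)// ?nnegrE ?mulr_ge0 ?cvnorm_ge0 ?sqrtr_ge0//.
  rewrite exprMn cvnorm_sqr (sqr_sqrtr (mxop_norm_ge0 _)) cvdot_mxstar mulmxA.
  apply: le_trans (cvdot_le _ _) _; rewrite mulrC expr2 mulrA.
  by rewrite ler_wpM2r ?cvnorm_ge0// cvnorm_mulmx.
have star_le b : mxop_norm b <= mxop_norm (mxstar b).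
  have := mxop_norm_ge0 b; rewrite le_eqVlt => /predU1P[<-|b0].
    exact: mxop_norm_ge0.
  have bb := le_trans (le b) (mxop_normM (mxstar b) b).
  by rewrite expr2 (ler_pM2r b0) in bb.
have e : mxop_norm (mxstar a) = mxop_norm a.
  apply/le_anti/andP; split; last exact: star_le.
  by have := star_le (mxstar a); rewrite mxstarK.
apply/le_anti/andP; split; last exact: le.
by have := mxop_normM (mxstar a) a; rewrite e expr2.
Qed.

(** The real and imaginary parts of each entry are Cauchy in [R], and the sum of the moduli of the
    entries dominates the norm. *)
Lemma mxop_norm_complete (v : nat -> 'M[C]_n.+1) :
  (forall e, 0 < e ->
    \forall p \near (\oo, \oo), mxop_norm (v p.1 - v p.2) < e) ->
  exists l, mxop_norm (v k - l) @[k --> \oo] --> (0 : R).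
Proof.
move=> cv; have lim_part (f : C -> R) : (forall z z', f (z - z') = f z - f z') ->
    (forall z, `|f z| <= cabs z) -> exists g : 'I_n.+1 * 'I_n.+1 -> R,
    forall p, f (v k p.1 p.2) @[k --> \oo] --> g p.
  move=> fB f_le; suff : forall p : 'I_n.+1 * 'I_n.+1, exists r : R,
      f (v k p.1 p.2) @[k --> \oo] --> r.
    by move=> /choice[g hg]; exists g.
  move=> [i j]; apply/cvg_ex; apply/cauchy_cvgP/cauchy_ballP => e e0.
  have := cv _ e0; rewrite near_map2; apply: filterS => -[k l] /= kl.
  rewrite /ball/= -fB; apply: le_lt_trans kl.
  apply: le_trans (f_le _) _.
  by have := cabs_le_mxop_norm (v k - v l) i j; rewrite !mxE.
have ReB (z z' : C) : complex.Re (z - z') = complex.Re z - complex.Re z'.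
  by case: z z' => ? ? [].
have ImB (z z' : C) : complex.Im (z - z') = complex.Im z - complex.Im z'.
  by case: z z' => ? ? [].
have [re hre] := lim_part (@complex.Re R) ReB cabs_Re.
have [im him] := lim_part (@complex.Im R) ImB cabs_Im.
exists (\matrix_(i, j) Complex (re (i, j)) (im (i, j))).
pose w k := \sum_i \sum_j
  (`|complex.Re (v k i j) - re (i, j)| + `|complex.Im (v k i j) - im (i, j)|).
apply: (@squeeze_cvgr _ _ _ _ (fun=> 0) w); last 2 first.
- exact: cvg_cst.
- rewrite (_ : 0 = \sum_(i < n.+1) \sum_(j < n.+1)
      (`|re (i, j) - re (i, j)| + `|im (i, j) - im (i, j)|)).
    apply: cvg_big => [|i _]; first exact: add_continuous.
    apply: cvg_big => [|j _]; first exact: add_continuous.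
    apply: cvgD; apply: cvg_norm; apply: cvgB; try exact: cvg_cst.
      exact: (hre (i, j)).
    exact: (him (i, j)).
  by rewrite big1// => i _; rewrite big1// => j _; rewrite !subrr normr0 addr0.
apply: nearW => k; rewrite mxop_norm_ge0/=.
apply: le_trans (mxop_norm_sum _) _.
apply: ler_sum => i _; apply: ler_sum => j _.
apply: le_trans (cabs_le _) _; rewrite !mxE.
by case: (v k i j).
Qed.

HB.instance Definition _ := isCStar.Build R 'M[C]_n.+1
  mxop_norm_eq0 mxop_normD mxop_normZ mxop_normM mxop_norm_complete
  mxstarP mxstarM mxstarK mxop_norm_star.

End MatrixCStar.


(** * The coaction *)

Section SwapRepresentation.
Context (R : realType) (n : nat) (i j : 'I_n).
Local Notation M2 := 'M[R[i]]_2.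

(** Boolean entries make every such matrix a projection and reduce products to conjunctions. *)
Definition diag2 (a b : bool) : M2 :=
  diag_mx (\row_k (if k == 0 then a else b)%:R).

(** The direct sum of two permutation matrices, those of the identity and of the transposition of i
    and j. *)
Definition swap_u (k l : 'I_n) : M2 := diag2 (k == l) (k == tperm i j l).

Definition swap_P : M2 := const_mx 2^-1.

Lemma diag2M a b a' b' : diag2 a b * diag2 a' b' = diag2 (a && a') (b && b').
Proof.
rewrite -[LHS]/(_ *m _) mulmx_diag; congr diag_mx; apply/rowP => k; rewrite !mxE.
by case: ifP => _; rewrite -natrM mulnb.
Qed.

Lemma diag2_star a b : star (diag2 a b) = diag2 a b.
Proof.
rewrite -[LHS]/(mxstar _); apply/matrixP => k l; rewrite !mxE (eq_sym l k).
have [->|_] := eqVneq k l; last by rewrite !mulr0n rmorph0.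
by rewrite !mulr1n; exact: rmorph_nat.
Qed.

Lemma diag2_sum (f g : 'I_n -> bool) :
  \sum_k diag2 (f k) (g k) = diag_mx (\row_p (if p == 0 then \sum_k (f k)%:R else \sum_k (g k)%:R)).
Proof.
rewrite /diag2 -(raddf_sum (@diag_mx _ _)); congr diag_mx; apply/rowP => p.
by rewrite summxE mxE; case: ifP => p0; apply: eq_bigr => k _; rewrite mxE p0.
Qed.

(** The scalar is <d e, e> for the diagonal matrix d and the unit vector e along (1, 1); it is
    symmetric in the two entries. *)
Lemma swap_P_diag2 a b : swap_P * diag2 a b * swap_P = ((a + b)%N%:R / 2) *: swap_P.
Proof.
rewrite -[swap_P * _]/(swap_P *m _) -[LHS]/(_ *m _) mul_mx_diag.
apply/matrixP => p q; rewrite !mxE !big_ord_recl big_ord0 !mxE /=.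
by rewrite natrD; field.
Qed.

Lemma swap_Bs_relations : Bs_relations swap_u swap_P.
Proof.
split.
- by move=> k l; split; [exact: diag2_star|rewrite /swap_u diag2M !andbb].
- split.
    rewrite -[LHS]/(mxstar _); apply/matrixP => k l; rewrite !mxE.
    by rewrite fmorphV rmorph_nat.
  rewrite -[LHS]/(_ *m _).
  apply/matrixP => p q; rewrite !mxE !big_ord_recl big_ord0 !mxE /=.
  by field.
- move=> k l l' ll'; rewrite /swap_u diag2M.
  have -> : (k == l) && (k == l') = false.
    by apply/negP => /andP[/eqP kl /eqP kl']; rewrite -kl -kl' eqxx in ll'.
  have -> : (k == tperm i j l) && (k == tperm i j l') = false.
    apply/negP => /andP[/eqP kl /eqP kl'].
    by have /perm_inj h : tperm i j l = tperm i j l'; [rewrite -kl|rewrite h eqxx in ll'].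
  by apply/matrixP => p q; rewrite !mxE if_same mul0rn.
- move=> l k k' kk'; rewrite /swap_u diag2M.
  have -> : (k == l) && (k' == l) = false.
    by apply/negP => /andP[/eqP kl /eqP kl']; rewrite kl kl' eqxx in kk'.
  have -> : (k == tperm i j l) && (k' == tperm i j l) = false.
    by apply/negP => /andP[/eqP kl /eqP kl']; rewrite kl kl' eqxx in kk'.
  by apply/matrixP => p q; rewrite !mxE if_same mul0rn.
(* A column of a permutation matrix contains a single 1, so the sum of the [swap_u k l] over k is
   already the identity. *)
- move=> l; rewrite -mulr_suml -[LHS]mul1r; congr (_ * _).
  rewrite /swap_u diag2_sum.
  have s1 (m : 'I_n) : \sum_(k < n) (k == m)%:R = 1 :> R[i].
    rewrite (bigD1 m)//= eqxx big1 ?addr0// => k /negbTE->.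
    by [].
  by apply/matrixP => p q; rewrite !mxE !s1 if_same.
Qed.

Lemma swap_P_neq0 : swap_P != 0.
Proof. by apply/eqP => /matrixP/(_ 0 0)/eqP; rewrite !mxE invr_eq0 pnatr_eq0. Qed.

Lemma swap_P_uB k : swap_P * (swap_u k i - swap_u k j) * swap_P = 0.
Proof.
rewrite mulrBr mulrBl !swap_P_diag2 tpermL tpermR addnC.
by rewrite addnC subrr.
Qed.

End SwapRepresentation.

(** * Invariance and moments of words *)

Section InvariantMoments.
Context (R : realType) (H : hilbertType R) (phi : (H -> H) -> R[i]).
Context (n : nat) (x : 'I_n -> H -> H).
Context (B : cstarType R) (u : 'I_n -> 'I_n -> B) (P : B).

(** As an instance of [mmap], [tensor_id] inherits additivity. *)
Lemma tensor_idE mu (q : ncpoly B n) :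
  tensor_id mu q = mmap idfun (fun w => mu (monom 1 w) *: 1) q.
Proof.
by rewrite mmapE; apply: eq_bigr => w _; rewrite -scalerAr mulr1.
Qed.

Lemma tensor_idB mu (q r : ncpoly B n) :
  tensor_id mu (q - r) = tensor_id mu q - tensor_id mu r.
Proof. by rewrite !tensor_idE raddfB. Qed.

Lemma tensor_id_sum (I : Type) (s : seq I) mu (F : I -> ncpoly B n) :
  tensor_id mu (\sum_(i <- s) F i) = \sum_(i <- s) tensor_id mu (F i).
Proof.
rewrite tensor_idE raddf_sum.
by apply: eq_bigr => i _; rewrite tensor_idE.
Qed.

Lemma eval_wordM v w : eval_word x (mul v w) = eval_word x v \o eval_word x w.
Proof.
rewrite /eval_word [fmonom_val (mul v w)]fmM foldr_cat.
by elim: (fmonom_val v) => //= i s ->.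
Qed.

Lemma eval_wordU i : eval_word x (fmu i) = x i.
Proof. by rewrite /eval_word fmU. Qed.

Lemma eval_word1 : eval_word x one = idfun.
Proof. by rewrite /eval_word fm1. Qed.

Section Kernel.
Context (D : cstarType R) (f : B -> D) (fm : star_morphism f).

Let f0 : f 0 = 0.
Proof.
have := star_morphism_linear fm 1 0 0.
by rewrite !scale1r addr0 => /esym/(canRL (addrK _)); rewrite subrr.
Qed.

Let fD : {morph f : a b / a + b}.
Proof. by move=> a b; have := star_morphism_linear fm 1 a b; rewrite !scale1r. Qed.

Let fsum (I : Type) (s : seq I) (F : I -> B) :
  f (\sum_(i <- s) F i) = \sum_(i <- s) f (F i).
Proof. exact: (big_morph f fD f0). Qed.

Let fZ (c : R[i]) b : f (c *: b) = c *: f b.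
Proof. by have := star_morphism_linear fm c b 0; rewrite f0 !addr0. Qed.

(** The kernel of the map that applies [f] to all coefficients; the next two lemmas make it a
    two-sided ideal. *)
Definition coef_kernel (q : ncpoly B n) := forall w, f (mcoeff w q) = 0.

Let fMn b (c : bool) : f b = 0 -> f (b *+ c) = 0.
Proof. by case: c; rewrite ?mulr1n ?mulr0n. Qed.

Lemma coef_kernelMl q r : coef_kernel q -> coef_kernel (r * q).
Proof.
move=> kq w; rewrite (monalgE r) (monalgE q) mulr_suml raddf_sum fsum big1// => v _.
rewrite mulr_sumr raddf_sum fsum big1// => v' _.
rewrite monomM /monom /= mcoeffU; apply: fMn.
by rewrite (star_morphismM fm) kq mulr0.
Qed.

Lemma coef_kernelMr q r : coef_kernel q -> coef_kernel (q * r).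
Proof.
move=> kq w; rewrite (monalgE r) (monalgE q) mulr_suml raddf_sum fsum big1// => v _.
rewrite mulr_sumr raddf_sum fsum big1// => v' _.
rewrite monomM /monom /= mcoeffU; apply: fMn.
by rewrite (star_morphismM fm) kq mul0r.
Qed.

Lemma tensor_id_kernel mu q : coef_kernel q -> f (tensor_id mu q) = 0.
Proof.
by move=> kq; rewrite fsum big1// => w _; rewrite fZ kq scaler0.
Qed.

(** For p l = X_a X_l X_b, the elements L'_n(p i) and L'_n(p j) differ by an element of the ideal
    [coef_kernel], because L'_n is multiplicative. Invariance and [f] turn this into equality of the
    two moments times f P, which is nonzero. *)
Lemma invariant_moments i j a b : P * P = P ->
  f P != 0 -> (forall k, f (P * (u k i - u k j) * P) = 0) ->
  coaction_invariant u P (joint_distribution phi x) ->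
  phi (eval_word x a \o x i \o eval_word x b) =
  phi (eval_word x a \o x j \o eval_word x b).
Proof.
move=> PP fP0 fij inv.
have [p muE LE] : exists2 p : 'I_n -> ncpoly R[i] n,
    forall l, joint_distribution phi x (p l) =
      phi (eval_word x a \o x l \o eval_word x b) &
    forall l, coaction u P (p l) =
      coaction u P (monom 1 a) * coaction u P (ncX _ l) * coaction u P (monom 1 b).
  exists (fun l => monom 1 a * ncX _ l * monom 1 b) => l.
    rewrite /ncX !monomM !mulr1.
    by rewrite joint_distribution_monom mul1r !eval_wordM eval_wordU.
  by rewrite -(coactionM _ PP) -(coactionM _ PP).
have hl l : phi (eval_word x a \o x l \o eval_word x b) *: P =
    tensor_id (joint_distribution phi x) (coaction u P (p l)).
  by rewrite -muE; exact: inv.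
have ker_ij : coef_kernel (coaction u P (ncX _ i) - coaction u P (ncX _ j)).
  move=> w; rewrite !(coactionX _ PP) -sumrB raddf_sum fsum big1// => k _.
  rewrite /= mcoeffB /monom (mcoeffU _ (P * u k i * P)) (mcoeffU _ (P * u k j * P)).
  rewrite -mulrnBl; apply: fMn.
  by rewrite -mulrBl -mulrBr fij.
have ker_p : coef_kernel (coaction u P (p i) - coaction u P (p j)).
  rewrite (LE i) (LE j) -mulrBl -mulrBr.
  by apply: coef_kernelMr; exact: coef_kernelMl.
have := tensor_id_kernel (joint_distribution phi x) ker_p.
rewrite (etrans (tensor_idB _ _ _)
  (congr2 (fun b c => b - c) (esym (hl i)) (esym (hl j)))).
rewrite -scalerBl fZ => /eqP; rewrite scaler_eq0 (negbTE fP0) orbF subr_eq0.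
by move/eqP.
Qed.

End Kernel.

(** A moment now depends on the length of the word alone, so the sum over the k of each letter falls
    on the coefficients, where the column relation collapses it. *)
Lemma constant_invariant (y : H -> H) : P * P = P -> (forall i, P = \sum_k u k i * P) ->
  (forall i, x i = y) -> coaction_invariant u P (joint_distribution phi x).
Proof.
move=> PP Psum xy.
have evalE w : eval_word x w = iter (size (fmonom_val w)) (fun T => y \o T) idfun.
  by rewrite /eval_word; elim: (fmonom_val w) => //= i s ->; rewrite xy.
pose m k := phi (iter k (fun T : H -> H => y \o T) idfun).
have muE w : joint_distribution phi x (monom 1 w) = m (size (fmonom_val w)).
  by rewrite joint_distribution_monom mul1r evalE.
have gen_sum i (b : B) : b * P = b -> \sum_k b * (P * u k i * P) = b.
  move=> bP; rewrite -mulr_sumr; under eq_bigr => k _ do rewrite -mulrA.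
  by rewrite -mulr_sumr -Psum PP.
(* The induction needs an arbitrary prefix [v] and coefficient [b]: each letter of [s] lengthens [v]
   by one and multiplies [b] by some P u_{k,i} P. *)
have tensor_prod (s : seq 'I_n) (b : B) v : b * P = b ->
    tensor_id (joint_distribution phi x) (monom b v * \prod_(i <- s) coaction_gen u P i)
    = m (size (fmonom_val v) + size s)%N *: b.
  elim: s b v => [|i s IH] b v bP.
    by rewrite big_nil mulr1 tensor_id_monom muE addn0.
  rewrite big_cons mulrA {1}/coaction_gen mulr_sumr mulr_suml tensor_id_sum.
  rewrite -[in RHS](gen_sum i b bP) scaler_sumr; apply: eq_bigr => k _.
  rewrite monomM IH; last by rewrite -!mulrA PP.
  by rewrite [fmonom_val (mul v _)]fmM [fmonom_val (fmu _)]fmU size_cat -addnA.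
move=> p; have -> : coaction u P p =
    \sum_(w <- msupp p) coaction u P (monom (mcoeff w p) w).
  by rewrite {1}(monalgE p) Defs.coaction_sum.
rewrite tensor_id_sum scaler_suml; apply: eq_bigr => w _.
rewrite coaction_monom /coaction_word mulrA monomM mul1m -scalerAl mul1r.
rewrite tensor_prod; last by rewrite -scalerAl PP.
by rewrite fm1 add0n scalerA evalE mulrC.
Qed.

End InvariantMoments.

(** * The unital algebra generated by the variables *)

Section GeneratedAlgebra.
Context (R : realType) (H : hilbertType R).
Implicit Types (S T : H -> H) (A G : set (H -> H)).

Lemma smallest_unital_subalgebra G : unital_subalgebra (smallest (@unital_subalgebra R H) G).
Proof.
split.
- by move=> A [[]].
- by move=> c S T hS hT A AG; case: (AG) => -[_ AP _] _; apply: AP; [exact: hS|exact: hT].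
- by move=> S T hS hT A AG; case: (AG) => -[_ _ AM] _; apply: AM; [exact: hS|exact: hT].
Qed.

Lemma hdotDr (x y z : H) : hdot z (x + y) = hdot z x + hdot z y.
Proof. by rewrite hdotC hdotDl rmorphD/= -!hdotC. Qed.

Lemma hdotZr (c : R[i]) (x z : H) : hdot z (c *: x) = c^* * hdot z x.
Proof. by rewrite hdotC hdotZl rmorphM/= -hdotC. Qed.

(** The operators with an adjoint in the generated algebra form a unital subalgebra containing
    [G]. *)
Lemma smallest_unital_subalgebra_adjoint G : (forall S, G S -> selfadjoint S) ->
  forall S, smallest (@unital_subalgebra R H) G S ->
  exists2 S', smallest (@unital_subalgebra R H) G S' & adjoint S S'.
Proof.
move=> Gsa S; have [A1 AP AM] := smallest_unital_subalgebra G.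
set A := smallest _ G in A1 AP AM *.
move: S; apply: smallest_sub; last first.
  by move=> S GS; exists S; [exact: sub_gen_smallest|exact: Gsa].
split; first by exists idfun.
- move=> c S T [S' AS' SS'] [T' AT' TT'].
  exists (c^* *: S' + T') => [|x y]; first exact: AP.
  have -> : (c *: S + T) x = c *: S x + T x by [].
  have -> : (c^* *: S' + T') y = c^* *: S' y + T' y by [].
  by rewrite hdotDl hdotZl hdotDr hdotZr conjCK SS' TT'.
- move=> S T [S' AS' SS'] [T' AT' TT'].
  exists (T' \o S') => [|x y]; first exact: AM.
  by rewrite /= SS' TT'.
Qed.

Context (phi : (H -> H) -> R[i]) (A : set (H -> H)).
Hypothesis vA : von_neumann_algebra A.
Hypothesis nphi : normal_state A phi.
Context (n : nat) (x : 'I_n -> H -> H) (Ax : forall i, A (x i)).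
Local Notation A0 := (smallest (@unital_subalgebra R H) (range x)).

Let A1 : A idfun. Proof. by have [] := vna_unital_subalgebra vA. Qed.
Let AP : forall (c : R[i]) S T, A S -> A T -> A (c *: S + T).
Proof. by have [] := vna_unital_subalgebra vA. Qed.
Let AM : forall S T, A S -> A T -> A (S \o T).
Proof. by have [] := vna_unital_subalgebra vA. Qed.

Lemma eval_word_in w : A (eval_word x w).
Proof. by rewrite /eval_word; elim: (fmonom_val w) => //= i s IH; exact: AM. Qed.

Lemma generated_sub : A0 `<=` A.
Proof. by apply: smallest_sub; [exact: vna_unital_subalgebra|move=> _ [i _ <-]]. Qed.

(** Induction on the generated algebra, one side at a time. [K] is stable under left multiplication
    by a generator because a word followed by a letter is a word; [K'] is its mirror image. Taking
    the empty word at the end removes the auxiliary factor. *)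
Lemma state_generated_eq0 T : A T ->
  (forall v w, phi (eval_word x v \o T \o eval_word x w) = 0) ->
  forall S S', A0 S -> A0 S' -> phi (S \o T \o S') = 0.
Proof.
move=> AT Tvw.
pose K : set (H -> H) := [set U | A U /\ forall v, phi (eval_word x v \o U) = 0].
have KM S : A0 S -> forall U, K U -> K (S \o U).
  move: S; apply: smallest_sub.
    split=> [U //|c S S' KS KS' U KU|S S' KS KS' U KU]; last exact: (KS _ (KS' _ KU)).
    have [AS S0] := KS _ KU; have [AS' S'0] := KS' _ KU.
    split; first exact: (AP c AS AS').
    move=> v; have -> : eval_word x v \o ((c *: S + S') \o U) =
        c *: (eval_word x v \o (S \o U)) + (eval_word x v \o (S' \o U)).
      by apply/funext => h; exact: (vna_bounded vA (eval_word_in v)).1.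
    rewrite (state_linear nphi); [|exact: AM (eval_word_in v) _..].
    by rewrite S0 S'0 mulr0 addr0.
  move=> _ [i _ <-] U [AU U0]; split=> [|v]; first exact: AM.
  have -> : eval_word x v \o (x i \o U) = eval_word x (mul v (fmu i)) \o U.
    by rewrite eval_wordM eval_wordU.
  exact: U0.
pose K' : set (H -> H) := [set U | A U /\ forall w, phi (U \o eval_word x w) = 0].
have KM' S : A0 S -> forall U, K' U -> K' (U \o S).
  move: S; apply: smallest_sub.
    split=> [U //|c S S' KS KS' U KU|S S' KS KS' U KU]; last exact: (KS' _ (KS _ KU)).
    have [AS S0] := KS _ KU; have [AS' S'0] := KS' _ KU.
    have UE : U \o (c *: S + S') = c *: (U \o S) + (U \o S').
      by apply/funext => h; exact: (vna_bounded vA KU.1).1.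
    split; first by rewrite UE; exact: AP.
    move=> w; rewrite UE.
    have -> : (c *: (U \o S) + (U \o S')) \o eval_word x w =
      c *: ((U \o S) \o eval_word x w) + ((U \o S') \o eval_word x w) by [].
    rewrite (state_linear nphi); [|exact: AM _ (eval_word_in w)..].
    by rewrite S0 S'0 mulr0 addr0.
  move=> _ [i _ <-] U [AU U0]; split=> [|w]; first exact: AM.
  have -> : U \o x i \o eval_word x w = U \o eval_word x (mul (fmu i) w).
    by rewrite eval_wordM eval_wordU.
  exact: U0.
move=> S S' AS AS'.
(* The left factor is treated with the word w on the right fixed, which is what membership in [K']
   asks for. *)
have K'ST : K' (S \o T).
  split; first exact: AM (generated_sub AS) AT.
  move=> w; have : K (T \o eval_word x w).
    by split; [exact: AM AT (eval_word_in w)|move=> v; exact: Tvw].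
  by move=> /(KM _ AS)[_ /(_ one)]; rewrite eval_word1.
have [_ /(_ one)] := KM' _ AS' _ K'ST.
by rewrite eval_word1.
Qed.

End GeneratedAlgebra.

Theorem proposition8p1 (R : realType) (H : hilbertType R)
    (A : set (H -> H)) (phi : (H -> H) -> R[i])
    (n : nat) (x : 'I_n -> H -> H)
    (B : cstarType R) (u : 'I_n -> 'I_n -> B) (P : B) :
  von_neumann_algebra A ->
  normal_state A phi ->
  nondegenerated A phi ->
  (forall i, A (x i)) ->
  (forall i, selfadjoint (x i)) ->
  A = wot_closure (smallest (@unital_subalgebra R H) (range x)) ->
  is_Bs u P ->
  coaction_invariant u P (joint_distribution phi x) <-> (forall i j, x i = x j).
Proof.
move=> vA nphi nondeg Ax xsa AE [Brel Buniv].
have PP : P * P = P by have [_] := Bs_projP Brel.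
split=> [inv i j|xij]; last first.
  (* For n = 0 there is no variable to choose, and the identity serves as common value. *)
  have [y xy] : exists y, forall i, x i = y.
    have [[i _]|no] := pselect (exists i : 'I_n, True); first by exists (x i) => k.
    by exists idfun => i; exfalso; apply: no; exists i.
  exact: (constant_invariant phi PP (Bs_sum Brel) xy).
have [f [[fm fu fP] _]] := Buniv _ _ _ (swap_Bs_relations R i j).
have fP0 : f P != 0 by rewrite fP swap_P_neq0.
have fij k : f (P * (u k i - u k j) * P) = 0.
  have fB a b : f (a - b) = f a - f b.
    by rewrite addrC -scaleN1r (star_morphism_linear fm) scaleN1r addrC.
  by rewrite !(star_morphismM fm) fB !fu fP swap_P_uB.
have [A1 AP AM] := vna_unital_subalgebra vA.
have AB S T : A S -> A T -> A (S - T).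
  by move=> AS AT; have := AP (-1) _ _ AT AS; rewrite scaleN1r addrC.
set A0 := smallest _ _ in AE.
have A0A : A0 `<=` A by exact: generated_sub.
have A0adj : forall S, A0 S -> exists2 S', A0 S' & adjoint S S'.
  apply: smallest_unital_subalgebra_adjoint => _ [k _ <-]; exact: xsa.
have A0alg : unital_subalgebra A0 by exact: smallest_unital_subalgebra.
have AT : A (x i - x j) by exact: AB.
have phi0 S S' : A0 S -> A0 S' -> phi (S \o (x i - x j) \o S') = 0.
  move=> AS AS'; apply: (state_generated_eq0 vA nphi Ax AT) => // v w.
  have Av := eval_word_in vA Ax v; have Aw := eval_word_in vA Ax w.
  have -> : eval_word x v \o (x i - x j) \o eval_word x w =
      (eval_word x v \o x i \o eval_word x w) -
      (eval_word x v \o x j \o eval_word x w).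
    by apply/funext => h; exact: (linear_subr (vna_bounded vA Av).1).
  rewrite addrC -scaleN1r (state_linear nphi); [|exact: AM _ _ (AM _ _ Av (Ax _)) Aw..].
  by rewrite (invariant_moments fm v w PP fP0 fij inv) mulN1r addNr.
apply/eqP; rewrite -subr_eq0; apply/eqP; apply: nondeg => // S S' AS AS'.
(* The left factor moves from [A0] to [A] while the right one stays in [A0]; the last line then
   moves the right factor. *)
have phi1 S0 : A0 S0 -> phi (S \o (x i - x j) \o S0) = 0.
  move=> A0S0; have AQ := AM _ _ AT (A0A _ A0S0).
  apply: (normal_state_dense vA nphi A0alg A0A A0adj AE A1 AQ _ AS).
  by move=> T A0T; exact: (phi0 _ _ A0T A0S0).
exact: (normal_state_dense vA nphi A0alg A0A A0adj AE (AM _ _ AS AT) A1 phi1 AS').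
Qed.
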